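(* Let $\mathcal{D}$ be the Delaunay triangulation and $\mathcal{V}=\mathcal{D}^*$ the Voronoi tessellation of a homogeneous Poisson point process of intensity $1$ in $\mathbb{R}^2$. Let $p_c$ be the critical probability for bond percolation on $\mathcal{D}$ and $p_c^*$ the critical probability for bond percolation on $\mathcal{V}$, as defined in the context. Then $$1\le p_c+p_c^*.$$
   Context: Let $\mathcal{P}$ be the set of points of a homogeneous Poisson point process of intensity $1$ in $\mathbb{R}^2$. For $\mathbf{v}\in\mathcal{P}$ the Voronoi tile $\mathbf{C}_{\mathbf{v}}$ is the (open) set of points of $\mathbb{R}^2$ that are closer to $\mathbf{v}$ than to any other $\mathbf{v}'\in\mathcal{P}$. The Delaunay triangulation $\mathcal{D}$ is the graph with vertex set $\mathcal{P}$ and edge set consisting of the non-oriented pairs $(\mathbf{v},\mathbf{v}')$ such that $\mathbf{C}_{\mathbf{v}}$ and $\mathbf{C}_{\mathbf{v}'}$ share a one-dimensional edge. The Voronoi tessellation $\mathcal{V}=\mathcal{D}^*$ is the graph whose vertices and edges are the vertices and edges of the Voronoi tiles; it is the planar dual of $\mathcal{D}$. Critical probability $p_c$: $p_c:=\inf\{p>0:\theta(p)=1\}$, where $\theta(p)$ is the probability that bond percolation on $\mathcal{D}$ occurs with density $p$, i.e. the probability that there is an infinite connected cluster of open edges in $\mathcal{D}$ when each edge of $\mathcal{D}$ is open independently with probability $p$ (independently of $\mathcal{P}$). Critical probability $p_c^*$: let each edge of $\mathcal{V}$ be open independently with probability $p$, and let $\mathbb{P}^*_p$ be the joint law of the Poisson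 process and the edge states. An open path is a path composed of open edges. For a planar graph and $\mathbf{A},\mathbf{B}\subseteq\mathbb{R}^2$, a self-avoiding path $(\mathbf{v}_1,\dots,\mathbf{v}_k)$ connects $\mathbf{A}$ to $\mathbf{B}$ if $[\mathbf{v}_1,\mathbf{v}_2]\cap\mathbf{A}\ne\emptyset$ and $[\mathbf{v}_{k-1},\mathbf{v}_k]\cap\mathbf{B}\ne\emptyset$, where $[\mathbf{x},\mathbf{y}]$ is the line segment from $\mathbf{x}$ to $\mathbf{y}$. For $L>0$ let $A_L$ be the event that there is an open path $(\mathbf{v}_j)_{1\le j\le h}$ in $\mathcal{V}$ connecting $\{0\}\times[0,L]$ to $\{3L\}\times[0,L]$ with $\mathbf{v}_j\in[0,3L]\times[0,L]$ for all $j=2,\dots,h-1$. Set $\eta^*(p):=\liminf_{L\to\infty}\mathbb{P}^*_p(A_L)$ and $p_c^*:=\inf\{p>0:\eta^*(p)=1\}$. *)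

(* Defs.v *)
From mathcomp Require Import all_boot all_order all_algebra finmap.
From mathcomp Require Import all_classical all_reals all_analysis.
From mathcomp Require Import measurable_realfun.
From Stdlib Require Import Relation_Operators.

Set Implicit Arguments.
Unset Strict Implicit.
Unset Printing Implicit Defensive.

Import Order.TTheory GRing.Theory Num.Theory.
Import numFieldNormedType.Exports.

Local Open Scope classical_set_scope.
Local Open Scope ring_scope.

Section geometry.
Context {R : realType}.
Implicit Types (P A B : set (R * R)) (u v x y z : R * R).

(* The library norm on R * R is the sup norm, hence this explicit definition. *)
Definition edist x y : R :=
  Num.sqrt ((x.1 - y.1) ^+ 2 + (x.2 - y.2) ^+ 2).

Definition segment x y : set (R * R) :=
  [set z | exists2 t : R, 0 <= t <= 1 &
     z = ((1 - t) * x.1 + t * y.1, (1 - t) * x.2 + t * y.2)].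

Definition voronoi_tile P v : set (R * R) :=
  [set z | forall v', P v' -> v' <> v -> edist z v < edist z v'].

Definition common_side P v v' : set (R * R) :=
  closure (voronoi_tile P v) `&` closure (voronoi_tile P v').

(* The common side is convex and contained in a line, so it is one-dimensional
   exactly when it contains a nondegenerate segment. *)
Definition delaunay P v v' : Prop :=
  [/\ P v, P v', v <> v' &
    exists a b, a <> b /\ segment a b `<=` common_side P v v'].

(* [voronoi_edge P v v' a b]: the edge of the Voronoi graph dual to the Delaunay
   edge (v, v') has endpoints a and b.  The vertices of the Voronoi graph are
   the endpoints of its edges.  Unbounded sides, which almost surely do not
   occur, yield no edge. *)
Definition voronoi_edge P v v' a b : Prop :=
  delaunay P v v' /\ common_side P v v' = segment a b.

(* A configuration is an enumeration x of the points together with a state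
   (true for open) for each pair of labels.  Edges are not oriented, so the edge
   between x i and x j and the dual edge both read the state of
   (minn i j, maxn i j); the states of the other pairs play no role. *)
Definition delaunay_open (x : nat -> R * R) (s : nat * nat -> bool) u v : Prop :=
  exists i j, [/\ u = x i, v = x j, delaunay (range x) u v &
    s (minn i j, maxn i j)].

Definition voronoi_open (x : nat -> R * R) (s : nat * nat -> bool) a b : Prop :=
  exists i j, voronoi_edge (range x) (x i) (x j) a b /\ s (minn i j, maxn i j).

Definition open_cluster (x : nat -> R * R) (s : nat * nat -> bool) u
    : set (R * R) :=
  [set v | clos_refl_trans (R * R)%type (delaunay_open x s) u v].

Definition percolates (x : nat -> R * R) (s : nat * nat -> bool) : Prop :=
  exists i, infinite_set (open_cluster x s (x i)).

(* Paths (v_1, ..., v_h) are functions v : nat -> R * R read on 1 <= j <= h. *)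
Definition self_avoiding_path (E : R * R -> R * R -> Prop) (h : nat)
    (v : nat -> R * R) : Prop :=
  [/\ (2 <= h)%N,
      forall j, (1 <= j < h)%N -> E (v j) (v j.+1) &
      forall j k, (1 <= j <= h)%N -> (1 <= k <= h)%N -> v j = v k -> j = k].

Definition connects (h : nat) (v : nat -> R * R) A B : Prop :=
  segment (v 1%N) (v 2%N) `&` A !=set0 /\
  segment (v h.-1) (v h) `&` B !=set0.

Definition crossing (L : R) (x : nat -> R * R) (s : nat * nat -> bool) : Prop :=
  exists (h : nat) (v : nat -> R * R),
    [/\ self_avoiding_path (voronoi_open x s) h v,
        connects h v ([set 0] `*` `[0, L]) ([set 3 * L] `*` `[0, L]) &
        forall j, (2 <= j <= h.-1)%N -> (`[0, 3 * L] `*` `[0, L]) (v j)].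

End geometry.

Section probability.
Context {R : realType}.

Definition mutually_independent {d d'} {T : measurableType d}
    {T' : measurableType d'} (P : probability T R) (I : choiceType)
    (Y : I -> T -> T') : Prop :=
  forall (J : {fset I}) (B : I -> set T'), (forall i, measurable (B i)) ->
    P (\bigcap_(i in [set` J]) (Y i @^-1` B i)) =
    (\prod_(i <- J) P (Y i @^-1` B i))%E.

Definition area : set (R * R) -> \bar R :=
  (@lebesgue_measure R \x @lebesgue_measure R)%E.

Definition point_count {d} {T : measurableType d} (X : nat -> T -> R * R)
    (A : set (R * R)) (w : T) : \bar R :=
  counting (range (X ^~ w) `&` A).

(* The points of a homogeneous Poisson process of the given intensity,
   enumerated measurably and without repetition by X 0, X 1, ...
   The second argument of [poisson_prob] is a dummy. *)
Definition poisson_process {d} {T : measurableType d} (P : probability T R)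
    (intensity : R) (X : nat -> T -> R * R) : Prop :=
  [/\ forall n, measurable_fun setT (X n),
      forall w, injective (X ^~ w),
      forall w (A : set (R * R)), bounded_set A ->
        finite_set (range (X ^~ w) `&` A),
      forall A : set (R * R),
        measurable A -> (area A < +oo)%E -> forall k : nat,
        P [set w | point_count X A w = k%:R%:E] =
        poisson_prob (intensity * fine (area A)) k [set k] &
      forall A : nat -> set (R * R),
        (forall n, measurable (A n)) -> trivIset setT A ->
        mutually_independent P (fun n => point_count X (A n))].

Definition bernoulli_field {d} {T : measurableType d} (Q : probability T R)
    (p : R) (I : choiceType) (xi : I -> T -> bool) : Prop :=
  [/\ forall i, measurable_fun setT (xi i),
      forall i, Q [set e | xi i e] = p%:E &
      mutually_independent Q xi].

End probability.

(* mu is the law carrying the points and nu p the one carrying the edge states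
   at density p; as these are independent, the joint law is mu \x nu p. *)
Section percolation.
Context {R : realType} {d1 d2 : measure_display}.
Context {T1 : measurableType d1} {T2 : measurableType d2}.
Variables (mu : probability T1 R) (X : nat -> T1 -> R * R).
Variables (nu : R -> probability T2 R) (xi : nat * nat -> T2 -> bool).

Definition theta (p : R) : \bar R :=
  (mu \x nu p)%E [set we | percolates (X ^~ we.1) (xi ^~ we.2)].

(* The bound p <= 1 is needed since nu p is unspecified outside [0, 1].  The
   infimum is taken in \bar R, with the convention that inf set0 = +oo. *)
Definition p_c : \bar R :=
  ereal_inf [set p%:E | p in [set p : R | 0 < p <= 1 /\ theta p = 1%E]].

Definition eta_star (p : R) : \bar R :=
  limf_einf (fun L : R =>
    (mu \x nu p)%E [set we | crossing L (X ^~ we.1) (xi ^~ we.2)]) +oo%R.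

Definition p_c_star : \bar R :=
  ereal_inf [set p%:E | p in [set p : R | 0 < p <= 1 /\ eta_star p = 1%E]].

End percolation.

(* Main.v *)
Require Import Defs.
From mathcomp Require Import all_boot all_order all_algebra finmap.
From mathcomp Require Import all_classical all_reals all_analysis.
From mathcomp Require Import measurable_realfun ring lra zify.
From Stdlib Require Import Relation_Operators.

(* [Defs.edist] is shadowed by the extended-real distance of MathComp-Analysis. *)
Import Defs.

Set Implicit Arguments.
Unset Strict Implicit.
Unset Printing Implicit Defensive.

Import Order.TTheory GRing.Theory Num.Theory.
Import numFieldNormedType.Exports.

Local Open Scope classical_set_scope.
Local Open Scope ring_scope.

(* Suppose p + q < 1, percolation occurs almost surely in the Delaunay
   triangulation at density p, and Voronoi crossings of [0, 6l] * [0, 2l] at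
   density q have probabilities tending to 1.  Couple the two fields so that no
   pair of dual edges is open in both.  A horizontal Voronoi crossing of a
   rectangle meets every path crossing it vertically, hence excludes vertical
   crossings by open Delaunay edges, which have therefore small probability.  By
   invariance of the Poisson process the same holds for the four rectangles
   around the square [-l, l]^2, one of which is crossed by any infinite cluster
   that meets the square.  So an infinite cluster exists with probability at
   most 1/2, a contradiction.

   Nothing is known about the measurability of these events in the point
   process.  The probabilities of the definitions are thus lower integrals, and
   Delaunay edges are replaced by a discretization: at mesh 1/(n+1), two points
   are linked when some disc contains their two cells and no other occupied
   cell.  The resulting event only depends on the occupation of finitely many
   cells, so that invariance is an identity between finite sums, and every
   Delaunay edge is seen for n large. *)

(** * Crossing paths *)

(** Only the easy half of planar duality enters: dual crossings of a rectangle exclude each other.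
    The aspect ratio 3 in [crossing] is that of the four rectangles around the square, so the
    crossings given by [eta_star] are used as they stand; a bound of 1/8 for each rectangle makes
    the 1/2. A straight Delaunay edge may run through the tiles of other points, and so meet Voronoi
    edges that are not its dual. Edges are therefore drawn as broken lines through the center of an
    empty disc, along which no third point is nearest. The measures [nu p] and [nu q] are two laws
    of the same variables, and no coupling is built on [T2]: it is an inequality between finite sums
    over edge states, reached by truncating the labels. Meshes are reciprocals of integers and [l]
    is an integer, so that the isometries between the rectangles preserve the cells. How fine the
    mesh must be depends on the points and on [l], hence lower limits of events, in [n] for each [l]
    and then in [l]. *)

Lemma square_three_colours (a00 a01 a10 a11 b00 b01 b10 b11 : bool) :
    let c2 a b := ~~ a && b in
    let c3 a b := ~~ a && ~~ b in
    let e a b a' b' := c2 a b && c3 a' b' || c3 a b && c2 a' b' in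
    e a10 b10 a11 b11 !=
      e a00 b00 a01 b01 (+) e a00 b00 a10 b10 (+) e a01 b01 a11 b11 ->
  [&& [|| a00, a01, a10 | a11], [|| c2 a00 b00, c2 a01 b01, c2 a10 b10 | c2 a11 b11]
    & [|| c3 a00 b00, c3 a01 b01, c3 a10 b10 | c3 a11 b11]].
Proof.
(* Without color 1 the color changes around a cycle are even in number; without color 2 or color 3
   there is no 2-3 edge at all. *)
by case: a00 a01 a10 a11 b00 b01 b10 b11 => -[] [] [] [] [] [] [].
Qed.

Lemma or4_corner (P : bool -> bool -> bool) :
  [|| P false false, P false true, P true false | P true true] ->
  exists a b, P a b.
Proof. by case/or4P => ?; do 2 eexists; eassumption. Qed.

(* Sperner's argument: color a vertex 1 when A holds, 2 when only B holds and 3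
   otherwise.  If no unit square has all colors, the parity of the number
   of 2-3 edges is the same on all the vertical lines of the grid. *)
Lemma grid_three_colours (N : nat) (A B : nat -> nat -> bool) :
    (forall j, A 0%N j) -> (forall j, ~~ A N j) ->
    (forall i, ~~ B i 0%N) -> (forall i, B i N) ->
  exists i j, [/\ (i < N)%N, (j < N)%N,
    exists a b : bool, A (i + a)%N (j + b)%N,
    exists a b : bool, ~~ A (i + a)%N (j + b)%N && B (i + a)%N (j + b)%N &
    exists a b : bool, ~~ A (i + a)%N (j + b)%N && ~~ B (i + a)%N (j + b)%N].
Proof.
move=> A0 AN B0 BN; apply: contrapT => nsq.
pose e i j i' j' :=
  (~~ A i j && B i j) && (~~ A i' j' && ~~ B i' j') ||
  (~~ A i j && ~~ B i j) && (~~ A i' j' && B i' j').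
have sq i j : (i < N)%N -> (j < N)%N ->
    e i.+1 j i.+1 j.+1 = e i j i j.+1 (+) e i j i.+1 j (+) e i j.+1 i.+1 j.+1.
  move=> iN jN; apply/eqP; apply: contrapT => /negP/square_three_colours.
  move=> /and3P[h1 h2 h3]; apply: nsq; exists i, j; split => //.
  - by apply: (@or4_corner (fun a b => A (i + a)%N (j + b)%N));
      rewrite !addn0 !addn1.
  - by apply: (@or4_corner (fun a b => ~~ A (i + a)%N (j + b)%N &&
      B (i + a)%N (j + b)%N)); rewrite !addn0 !addn1.
  - by apply: (@or4_corner (fun a b => ~~ A (i + a)%N (j + b)%N &&
      ~~ B (i + a)%N (j + b)%N)); rewrite !addn0 !addn1.
pose V i m := \big[addb/false]_(j < m) e i j i j.+1.
(* Adding [sq] over the squares below height [m] cancels the inner horizontal edges. The bottom line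
   has no color 2, so only the edge at height [m] is left. *)
have Vstep i m : (i < N)%N -> (m <= N)%N -> V i.+1 m = V i m (+) e i m i.+1 m.
  move=> iN; elim: m => [|m IH] mN.
    rewrite /V !big_ord0 /e !(negbTE (B0 _)) /= !andbF //.
  rewrite /V !big_ord_recr /= -/(V _ _) -/(V _ _) IH ?(ltnW mN)// sq//.
  by case: (V i m); case: (e i m i.+1 m); case: (e i m i m.+1);
     case: (e i m.+1 i.+1 m.+1).
have V0 m : V 0%N m = false.
  by rewrite /V big1 // => j _; rewrite /e !A0 /=.
have Vi i : (i <= N)%N -> V i N = false.
  elim: i => [|i IH] iN //; rewrite Vstep// IH ?(ltnW iN)//.
  by rewrite /e !BN /= !andbF.
(* On the line [i = N] there is no color 1, so the parity telescopes to the color change between the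
   ends. It is odd for the whole line, against [Vi]. *)
have VN m : V N m = B N m (+) B N 0%N.
  elim: m => [|m IH]; first by rewrite /V big_ord0 addbb.
  rewrite /V big_ord_recr /= -/(V _ _) IH /e !AN /=.
  by case: (B N m); case: (B N m.+1); case: (B N 0%N).
by have := Vi N (leqnn _); rewrite VN BN (negbTE (B0 _)).
Qed.

Section crossing_paths.
Context {R : realType}.
Implicit Types f g h k : R -> R.

Lemma unit_square_cluster (s t : nat -> R) :
    (forall n, 0 <= s n <= 1) -> (forall n, 0 <= t n <= 1) ->
  exists s0 t0, [/\ 0 <= s0 <= 1, 0 <= t0 <= 1 &
    forall (e : R) (m : nat), 0 < e ->
      exists2 n, (m <= n)%N & `|s n - s0| < e /\ `|t n - t0| < e].
Proof.
move=> s01 t01.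
have cK : compact ((`[0, 1] : set R) `*` (`[0, 1] : set R)).
  by apply: compact_setX; exact: segment_compact.
have sK : ((fun n => (s n, t n)) @ \oo) ((`[0, 1] : set R) `*` (`[0, 1] : set R)).
  by exists 0%N => // n _; split; rewrite /= in_itv/=.
have [[s0 t0] [/= [s0I t0I] cl]] := cK _ _ sK.
rewrite !in_itv /= in s0I t0I.
exists s0, t0; split => //.
move=> e m e0.
have [||[_ _] [/= [n mn [<- <-]] [/= sn tn]]] :=
  cl [set (s n, t n) | n in [set n | (m <= n)%N]] (ball s0 e `*` ball t0 e).
- by exists m => // n /= mn; exists n.
- exists (ball s0 e, ball t0 e) => //=; split; exact: nbhsx_ballx.
- by exists n => //; rewrite distrC (distrC (t n)).
Qed.

Lemma cvg_sign_ge0 f h (s0 t0 : R) : continuous f -> continuous h ->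
    (forall e, 0 < e -> exists s t, [/\ `|s - s0| < e, `|t - t0| < e & 0 <= f s - h t]) ->
  0 <= f s0 - h t0.
Proof.
move=> cf ch H; rewrite leNgt; apply/negP => lt0.
pose d := (h t0 - f s0) / 2.
have d0 : 0 < d by rewrite /d; lra.
have /cvgrPdist_lt /(_ _ d0) /nbhs_ballP[e1 /= e10 E1] := cf s0.
have /cvgrPdist_lt /(_ _ d0) /nbhs_ballP[e2 /= e20 E2] := ch t0.
have [|s [t [ss tt st]]] := H (Num.min e1 e2); first by rewrite lt_min e10.
move: ss tt; rewrite !lt_min => /andP[ss _] /andP[_ tt].
have := E1 s; rewrite /ball /= distrC => /(_ ss).
have := E2 t; rewrite /ball /= distrC => /(_ tt).
rewrite !ltr_norml /d; lra.
Qed.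

(** This is the Poincare-Miranda theorem for [(f s - h t, g s - k t)] on the unit square: the grid
    lemma gives arbitrarily small squares near which both coordinates take both weak signs, and a
    cluster point of these squares is a zero. *)
Lemma crossing_paths (a b : R) f g h k :
    continuous f -> continuous g -> continuous h -> continuous k ->
    (forall t, 0 <= t <= 1 -> 0 <= f t <= a) ->
    (forall t, 0 <= t <= 1 -> 0 <= g t <= b) ->
    (forall t, 0 <= t <= 1 -> 0 <= h t <= a) ->
    (forall t, 0 <= t <= 1 -> 0 <= k t <= b) ->
    f 0 = 0 -> f 1 = a -> k 0 = 0 -> k 1 = b ->
  exists s t, [/\ 0 <= s <= 1, 0 <= t <= 1, f s = h t & g s = k t].
Proof.
move=> cf cg ch ck fa gb ha kb f0 f1 k0 k1.
have sq (n : nat) : exists s t : R, [/\ 0 <= s <= 1, 0 <= t <= 1,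
   exists s' t', [/\ `|s' - s| <= n.+1%:R^-1, `|t' - t| <= n.+1%:R^-1 & f s' - h t' <= 0],
   exists s' t', [/\ `|s' - s| <= n.+1%:R^-1, `|t' - t| <= n.+1%:R^-1 & 0 <= f s' - h t'] &
   (exists s' t', [/\ `|s' - s| <= n.+1%:R^-1, `|t' - t| <= n.+1%:R^-1 & g s' - k t' <= 0]) /\
   exists s' t', [/\ `|s' - s| <= n.+1%:R^-1, `|t' - t| <= n.+1%:R^-1 & 0 <= g s' - k t']].
  pose N := n.+1; pose u (i : nat) : R := i%:R / N%:R.
  have N0 : 0 < N%:R :> R by rewrite ltr0n.
  have u01 i : (i <= N)%N -> 0 <= u i <= 1.
    by move=> iN; rewrite divr_ge0//= ler_pdivrMr// mul1r ler_nat.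
  have du i (c : bool) : `|u (i + c)%N - u i| <= n.+1%:R^-1.
    rewrite /u -mulrBl natrD addrAC subrr add0r normrM.
    rewrite (@ger0_norm _ (N%:R^-1)) ?invr_ge0// ger0_norm//.
    by case: c; rewrite ?mul1r// mul0r invr_ge0.
  (* The values on the sides are imposed, since a coordinate may vanish there; [AP] to [NBP] check
     that they agree with the weak signs. *)
  pose A i j := (i == 0%N) || ((i != N) && (f (u i) - h (u j) <= 0)).
  pose B i j := (j == N) || ((j != 0%N) && (g (u i) - k (u j) <= 0)).
  have u0 : u 0%N = 0 by rewrite /u mul0r.
  have uN : u N = 1 by rewrite /u divff// gt_eqF.
  have [||||i [j [iN jN [a1 [b1 h1]] [a2 [b2 /andP[h2 h2']]] [a3 [b3 /andP[h3 h3']]]]]] :=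
    @grid_three_colours N A B.
  - by move=> j; rewrite /A eqxx.
  - by move=> j; rewrite /A eqxx.
  - by move=> i; rewrite /B eqxx.
  - by move=> i; rewrite /B eqxx.
  have ule (m : nat) (c : bool) : (m < N)%N -> 0 <= u (m + c)%N <= 1.
    by move=> mN; apply: u01; case: c; rewrite ?addn1 ?addn0// ltnW.
  have AP i' j' : A i' j' -> (i' <= N)%N -> (j' <= N)%N -> f (u i') - h (u j') <= 0.
    move=> /orP[/eqP->|/andP[]//] _ jN'.
    by have := ha _ (u01 _ jN'); rewrite u0 f0; lra.
  have NAP i' j' : ~~ A i' j' -> (i' <= N)%N -> (j' <= N)%N -> 0 <= f (u i') - h (u j').
    rewrite negb_or negb_and negbK => /andP[_ /orP[/eqP->|hh]] _ jN';
      last by rewrite ltW// ltNge.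
    by have := ha _ (u01 _ jN'); rewrite uN f1; lra.
  have BP i' j' : B i' j' -> (i' <= N)%N -> (j' <= N)%N -> g (u i') - k (u j') <= 0.
    move=> /orP[/eqP->|/andP[]//] iN' _.
    by have := gb _ (u01 _ iN'); rewrite uN k1; lra.
  have NBP i' j' : ~~ B i' j' -> (i' <= N)%N -> (j' <= N)%N -> 0 <= g (u i') - k (u j').
    rewrite negb_or negb_and negbK => /andP[_ /orP[/eqP->|hh]] iN' _;
      last by rewrite ltW// ltNge.
    by have := gb _ (u01 _ iN'); rewrite u0 k0; lra.
  have le (m : nat) (c : bool) : (m < N)%N -> (m + c <= N)%N.
    by move=> mN; case: c; rewrite ?addn1 ?addn0// ltnW.
  exists (u i), (u j); split; [exact/u01/ltnW|exact/u01/ltnW| | |split].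
  - by exists (u (i + a1)%N), (u (j + b1)%N); split => //; apply: AP; rewrite // le.
  - by exists (u (i + a2)%N), (u (j + b2)%N); split => //; apply: NAP; rewrite // le.
  - by exists (u (i + a2)%N), (u (j + b2)%N); split => //; apply: BP; rewrite // le.
  - by exists (u (i + a3)%N), (u (j + b3)%N); split => //; apply: NBP; rewrite // le.
have [s /choice[t st]] := choice sq.
have [||s0 [t0 [s01 t01 cl]]] := @unit_square_cluster s t.
- by move=> n; have [] := st n.
- by move=> n; have [] := st n.
have close (P : R -> R -> Prop) :
    (forall n, exists s' t',
      [/\ `|s' - s n| <= n.+1%:R^-1, `|t' - t n| <= n.+1%:R^-1 & P s' t']) ->
    forall e, 0 < e -> exists s' t', [/\ `|s' - s0| < e, `|t' - t0| < e & P s' t'].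
  move=> H e e0.
  have e20 : 0 < e / 2 by lra.
  have /cvgrPdist_lt /(_ _ e20) [m _ mP] := @cvg_harmonic R.
  have [n mn [sn tn]] := cl _ m e20.
  have [s' [t' [ss' tt' P']]] := H n.
  have := mP n mn; rewrite sub0r normrN /= ger0_norm ?invr_ge0// => ne.
  exists s', t'; split => //.
    by move: (_^-1) ss' sn ne => w; rewrite ler_norml !ltr_norml; lra.
  by move: (_^-1) tt' tn ne => w; rewrite ler_norml !ltr_norml; lra.
have eq0 f' h' : continuous f' -> continuous h' ->
    (forall n, exists s' t',
      [/\ `|s' - s n| <= n.+1%:R^-1, `|t' - t n| <= n.+1%:R^-1 & f' s' - h' t' <= 0]) ->
    (forall n, exists s' t',
      [/\ `|s' - s n| <= n.+1%:R^-1, `|t' - t n| <= n.+1%:R^-1 & 0 <= f' s' - h' t']) ->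
    f' s0 = h' t0.
  move=> cf' ch' /close le0 /close ge0; apply/eqP.
  rewrite -subr_eq0 eq_le (cvg_sign_ge0 cf' ch' ge0) andbT -oppr_ge0 opprB.
  apply: cvg_sign_ge0 => // e /le0[s' [t' [ss tt st']]].
  by exists t', s'; split => //; rewrite -opprB oppr_ge0.
exists s0, t0; split => //; apply: eq0 => // n; have [_ _] := st n.
- by [].
- by [].
- by move=> _ _ [].
- by move=> _ _ [].
Qed.
End crossing_paths.

(** * Paths in plane sets and crossings of annuli *)

Section paths.
Context {R : realType}.
Implicit Types (A B : set (R * R)) (z w : R * R).

Definition joined A z w :=
  exists f g : R -> R, [/\ continuous f, continuous g, (f 0, g 0) = z,
    (f 1, g 1) = w & forall t, 0 <= t <= 1 -> A (f t, g t)].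

Lemma continuous_affine (a b : R) : continuous (fun t : R => a + b * t).
Proof.
move=> x; apply: cvgD; first exact: cvg_cst.
by apply: cvgM; [exact: cvg_cst|exact: cvg_id].
Qed.

Lemma joined_segment A z w : segment z w `<=` A -> joined A z w.
Proof.
case: z w => [z1 z2] [w1 w2] sA.
exists (fun t => z1 + (w1 - z1) * t), (fun t => z2 + (w2 - z2) * t).
split; [exact: continuous_affine|exact: continuous_affine| | |].
- by rewrite !mulr0 !addr0.
- by rewrite !mulr1; congr (_, _); ring.
- by move=> t t01; apply: sA; exists t => //=; congr (_, _); ring.
Qed.

Lemma joined_reparam A (f g : R -> R) (t0 t1 : R) :
    continuous f -> continuous g ->
    (forall t, Num.min t0 t1 <= t <= Num.max t0 t1 -> A (f t, g t)) ->
  joined A (f t0, g t0) (f t1, g t1).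
Proof.
move=> cf cg H.
pose u t := t0 + (t1 - t0) * t.
have cu : continuous u by exact: continuous_affine.
exists (f \o u), (g \o u); split.
- by move=> x; apply: continuous_comp; [exact: cu|exact: cf].
- by move=> x; apply: continuous_comp; [exact: cu|exact: cg].
- by rewrite /= /u mulr0 addr0.
- by rewrite /= /u mulr1 addrC subrK.
- move=> t /andP[t_ge0 t_le1]; apply: H; rewrite /u.
  rewrite ge_min le_max; case: (leP t0 t1) => t01.
    by apply/andP; split; apply/orP; [left|right]; nra.
  by apply/andP; split; apply/orP; [right|left]; nra.
Qed.

Lemma joined_sym A z w : joined A z w -> joined A w z.
Proof.
move=> [f [g [cf cg <- <- H]]]; apply: joined_reparam => // t.
by rewrite (min_idPr ler01) (max_idPl ler01); exact: H.
Qed.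

(* The two paths are glued as f1 (min (2 t) 1) + f2 (max (2 t - 1) 0) - f1 1,
   which makes continuity immediate. *)
Lemma joined_trans A z w w' : joined A z w -> joined A w w' -> joined A z w'.
Proof.
move=> [f1 [g1 [cf1 cg1 e0 e1 H1]]] [f2 [g2 [cf2 cg2 e2 e3 H2]]].
move: e2; rewrite -e0 -e1 -e3 => -[f12 g12].
pose u (t : R) := Num.min (0 + 2 * t) 1; pose v (t : R) := Num.max (- 1 + 2 * t) 0.
have cu : continuous u.
  move=> x; apply: (@continuous_min _ _ (fun t : R => 0 + 2 * t) (fun=> 1)).
    exact: continuous_affine.
  exact: cvg_cst.
have cv : continuous v.
  move=> x; apply: (@continuous_max _ _ (fun t : R => - 1 + 2 * t) (fun=> 0)).
    exact: continuous_affine.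
  exact: cvg_cst.
have glue h1 h2 : continuous h1 -> continuous h2 ->
    continuous (fun t => h1 (u t) + h2 (v t) - h1 1 : R).
  move=> c1 c2 x; apply: cvgB; last exact: cvg_cst.
  apply: cvgD; apply: (@continuous_comp _ _ _ _ _ x);
    [exact: cu|exact: c1|exact: cv|exact: c2].
exists (fun t => f1 (u t) + f2 (v t) - f1 1), (fun t => g1 (u t) + g2 (v t) - g1 1).
have [u0 v0 u1 v1] : [/\ u 0 = 0, v 0 = 0, u 1 = 1 & v 1 = 1].
  rewrite /u /v; split.
  - by rewrite min_l; lra.
  - by rewrite max_r; lra.
  - by rewrite min_r; lra.
  - by rewrite max_l; lra.
split; [exact: glue|exact: glue| | |].
- by rewrite u0 v0 f12 g12 !addrK.
- by rewrite u1 v1; congr (_, _); ring.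
- move=> t /andP[t_ge0 t_le1].
  have [t2|t2] := leP t (1 / 2).
    have -> : v t = 0 by rewrite /v max_r; lra.
    rewrite f12 g12 !addrK; apply: H1; rewrite /u min_l; lra.
  have -> : u t = 1 by rewrite /u min_r; lra.
  rewrite !(addrAC _ _ (- _)) !subrr !add0r; apply: H2; rewrite /v max_l; lra.
Qed.

Definition box (x1 x2 y1 y2 : R) : set (R * R) :=
  [set z | x1 <= z.1 <= x2 /\ y1 <= z.2 <= y2].

Lemma joined_crossing A B (a b : R) z z' w w' :
    joined (A `&` box 0 a 0 b) z z' -> z.1 = 0 -> z'.1 = a ->
    joined (B `&` box 0 a 0 b) w w' -> w.2 = 0 -> w'.2 = b ->
  A `&` B !=set0.
Proof.
move=> [f [g [cf cg <- <- H]]] /= f0 f1 [h [k [ch ck <- <- H']]] /= k0 k1.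
have [||||s [t [s01 t01 ht kt]]] :=
  crossing_paths (a := a) (b := b) cf cg ch ck _ _ _ _ f0 f1 k0 k1.
- by move=> t /H [_ []].
- by move=> t /H [_ []].
- by move=> t /H' [_ []].
- by move=> t /H' [_ []].
exists (h t, k t); split; last by have [] := H' _ t01.
by rewrite -ht -kt; have [] := H _ s01.
Qed.

Lemma first_passage (f : R -> R) (a b c : R) : continuous f -> a <= b ->
    f a <= c -> c <= f b ->
  exists2 t, a <= t <= b & f t = c /\ forall s, a <= s <= t -> f s <= c.
Proof.
move=> cf ab fa fb.
pose S := [set t | a <= t <= b /\ c <= f t].
have Sb : S b by split; rewrite ?ab ?lexx.
have infS : has_inf S by split; [exists b|exists a => x [/andP[]]].
pose t := inf S.
have at_ : a <= t by apply: lb_le_inf; [exists b|move=> x [/andP[]]].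
have tb : t <= b by apply: ge_inf => //; case: infS.
have lt_c s : a <= s < t -> f s < c.
  move=> /andP[as_ st]; rewrite ltNge; apply/negP => cs.
  suff : t <= s by rewrite leNgt st.
  apply: ge_inf; first by case: infS.
  by split => //; rewrite as_ (le_trans (ltW st)).
have ftc : c <= f t.
  rewrite leNgt; apply/negP => ftc.
  have d0 : 0 < c - f t by rewrite subr_gt0.
  have /cvgrPdist_lt /(_ _ d0) /nbhs_ballP[e /= e0 E] := cf t.
  have [x [Sx1 Sx2] xt] := inf_adherent e0 infS.
  have tx : t <= x by apply: ge_inf => //; case: infS.
  have := E x; rewrite /ball /= ltr_norml => /(_ _).
  rewrite -/t in xt.
  have : - e < t - x < e by apply/andP; split; lra.
  move=> h /(_ h); rewrite ltr_norml; lra.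
(* No time before [t] has a value at least [c], so the intermediate value found in [[a, t]] can only
   be taken at [t]. *)
have [u /andP[au ut] fu] : exists2 u, u \in `[a, t] & f u = c.
  apply: IVT => //; first by apply: continuous_subspaceT.
  by rewrite ge_min fa le_max ftc orbT.
have tu : t <= u.
  by apply: ge_inf; [case: infS|split; rewrite ?fu ?lexx//; move: au ut;
    rewrite !bnd_simp => -> /le_trans->].
move: ut; rewrite bnd_simp => ut.
have {tu} ut' : u = t by apply/eqP; rewrite eq_le ut tu.
exists t; first by rewrite at_ tb.
split; first by rewrite -ut'.
move=> s /andP[as_]; rewrite le_eqVlt => /orP[/eqP->|st]; first by rewrite -ut' fu.
by apply/ltW/lt_c; rewrite as_ st.
Qed.

Lemma last_passage (f : R -> R) (a b c : R) : continuous f -> a <= b ->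
    f a <= c -> c <= f b ->
  exists2 t, a <= t <= b & f t = c /\ forall s, t <= s <= b -> c <= f s.
Proof.
move=> cf ab fa fb.
have [||||t /andP[ta tb] [ft H]] := @first_passage (fun t => - f (- t)) (- b) (- a) (- c).
- by move=> x; apply: cvgN; apply: continuous_comp; [exact: opp_continuous|exact: cf].
- by rewrite lerN2.
- by rewrite lerN2 opprK.
- by rewrite lerN2 opprK.
exists (- t); first by apply/andP; split; lra.
split; first by rewrite -[RHS]opprK -ft opprK.
move=> s /andP[s1 s2]; have sI : - b <= - s <= t by apply/andP; split; lra.
by have := H _ sI; rewrite opprK lerN2.
Qed.

(** After the last visit to height [l] the path stays above it. The four sides of an annulus are
    instances of this one, with the coordinates exchanged or the sign of the second one changed. *)
Lemma vertical_passage (f g : R -> R) (l t : R) : continuous f -> continuous g ->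
    0 <= t -> g 0 <= l -> l <= g t ->
    (forall s, 0 <= s <= t -> `|f s| <= 3 * l /\ g s <= 3 * l) ->
  exists2 s, 0 <= s <= t & g s = l /\
     forall u, s <= u <= t -> box (- (3 * l)) (3 * l) l (3 * l) (f u, g u).
Proof.
move=> cf cg t0 g0 gt H.
have [s /andP[s0 st] [gs Hs]] := last_passage cg t0 g0 gt.
exists s; first by rewrite s0.
split => // u /andP[su ut].
have [|fu gu] := H u; first by rewrite (le_trans s0).
by split => /=; rewrite -?ler_norml// gu andbT Hs// su.
Qed.

(** The path is stopped when its sup norm first reaches [3 * l]. The coordinate responsible selects
    the rectangle, and its last visit to the inner level starts the crossing. Downward and leftward
    crossings are reversed, so that translations and a swap suffice later, without reflections. *)
Lemma annulus_crossing A (l : R) z w : 0 < l -> joined A z w ->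
    `|z.1| <= l -> `|z.2| <= l -> 3 * l <= Num.max `|w.1| `|w.2| ->
  [\/ exists z' w', [/\ joined (A `&` box (- (3 * l)) (3 * l) l (3 * l)) z' w',
        z'.2 = l & w'.2 = 3 * l],
      exists z' w', [/\ joined (A `&` box (- (3 * l)) (3 * l) (- (3 * l)) (- l)) z' w',
        z'.2 = - (3 * l) & w'.2 = - l],
      exists z' w', [/\ joined (A `&` box l (3 * l) (- (3 * l)) (3 * l)) z' w',
        z'.1 = l & w'.1 = 3 * l] |
      exists z' w', [/\ joined (A `&` box (- (3 * l)) (- l) (- (3 * l)) (3 * l)) z' w',
        z'.1 = - (3 * l) & w'.1 = - l]].
Proof.
move=> l0 [f [g [cf cg <- <- H]]] /= f0 g0 fg1.
pose N t := Num.max `|f t| `|g t|.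
have cN : continuous N.
  move=> x; apply: (@continuous_max _ _ (fun t : R => `|f t|) (fun t => `|g t|)).
    by apply: (@continuous_comp _ _ _ f); [exact: cf|exact: norm_continuous].
  by apply: (@continuous_comp _ _ _ g); [exact: cg|exact: norm_continuous].
have [|t /andP[t0 t1] [Nt HN]] := first_passage cN ler01 _ fg1.
  by rewrite /N ge_max; apply/andP; split; lra.
have HfN s : 0 <= s <= t -> `|f s| <= 3 * l.
  by move=> /HN; rewrite /N ge_max => /andP[].
have HgN s : 0 <= s <= t -> `|g s| <= 3 * l.
  by move=> /HN; rewrite /N ge_max => /andP[].
have tt : 0 <= t <= t by rewrite t0 lexx.
have cgN : continuous (fun t => - g t) by move=> x; apply: cvgN; exact: cg.
have cfN : continuous (fun t => - f t) by move=> x; apply: cvgN; exact: cf.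
have up (h : R) : `|h| <= l -> h <= l by move=> /ler_normlP[].
have Hup h (s : R) : `|h s| <= 3 * l -> h s <= 3 * l by move=> /ler_normlP[].
have seg s u : 0 <= s -> s <= u <= t -> 0 <= u <= 1.
  by move=> s0 /andP[su ut]; rewrite (le_trans s0 su) (le_trans ut t1).
have : [\/ g t = 3 * l, - g t = 3 * l, f t = 3 * l | - f t = 3 * l].
  move: Nt; rewrite /N; case: leP => _ h.
    have [h'|h'] := leP 0 (g t); first by apply: Or41; rewrite -(ger0_norm h').
    by apply: Or42; rewrite -(ltr0_norm h').
  have [h'|h'] := leP 0 (f t); first by apply: Or43; rewrite -(ger0_norm h').
  by apply: Or44; rewrite -(ltr0_norm h').
case=> ht.
- apply: Or41; have [|||s /andP[s0 st] [gs Hs]] := vertical_passage (l := l) cf cg t0.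
  + exact: up.
  + by rewrite ht; lra.
  + by move=> s st; split; [exact: HfN|apply: Hup; exact: HgN].
  exists (f s, g s), (f t, g t); split => //.
  apply: joined_reparam => // u; rewrite (min_idPl st) (max_idPr st) => su.
  by split; [apply: H; exact: seg su|exact: Hs].
- apply: Or42; have [|||s /andP[s0 st] [gs Hs]] := vertical_passage (l := l) cf cgN t0.
  + by apply: up; rewrite normrN.
  + by rewrite ht; lra.
  + by move=> s st; split; [exact: HfN|
      apply: (Hup (fun s => - g s)); rewrite normrN; exact: HgN].
  exists (f t, g t), (f s, g s); split => //=; [|lra|lra].
  apply: joined_reparam => // u; rewrite (min_idPr st) (max_idPl st) => su.
  split; first by apply: H; exact: seg su.
  by have [/= h1 h2] := Hs _ su; split => //=; lra.
- apply: Or43; have [|||s /andP[s0 st] [gs Hs]] := vertical_passage (l := l) cg cf t0.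
  + exact: up.
  + by rewrite ht; lra.
  + by move=> s st; split; [exact: HgN|apply: Hup; exact: HfN].
  exists (f s, g s), (f t, g t); split => //.
  apply: joined_reparam => // u; rewrite (min_idPl st) (max_idPr st) => su.
  by split; [apply: H; exact: seg su|have [] := Hs _ su].
- apply: Or44; have [|||s /andP[s0 st] [gs Hs]] := vertical_passage (l := l) cg cfN t0.
  + by apply: up; rewrite normrN.
  + by rewrite ht; lra.
  + by move=> s st; split; [exact: HgN|
      apply: (Hup (fun s => - f s)); rewrite normrN; exact: HfN].
  exists (f t, g t), (f s, g s); split => //=; [|lra|lra].
  apply: joined_reparam => // u; rewrite (min_idPr st) (max_idPl st) => su.
  split; first by apply: H; exact: seg su.
  by have [/= h1 h2] := Hs _ su; split => //=; lra.
Qed.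

End paths.

(** * Delaunay edges and empty discs *)

Section plane.
Context {R : realType}.
Implicit Types (P A : set (R * R)) (a b u v w z c : R * R).

Lemma sqr_edist z w : edist z w ^+ 2 = (z.1 - w.1) ^+ 2 + (z.2 - w.2) ^+ 2.
Proof. by rewrite sqr_sqrtr// addr_ge0// sqr_ge0. Qed.

Lemma edist_ge0 z w : 0 <= edist z w.
Proof. exact: sqrtr_ge0. Qed.

Lemma edistC z w : edist z w = edist w z.
Proof. by rewrite /edist -(opprB w.1) -(opprB w.2) !sqrrN. Qed.

Lemma edist_eq0 z w : edist z w = 0 -> z = w.
Proof.
move=> /(congr1 (fun x => x ^+ 2)); rewrite sqr_edist expr0n /= => /eqP.
rewrite paddr_eq0 ?sqr_ge0// !sqrf_eq0 !subr_eq0 => /andP[/eqP h1 /eqP h2].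
by rewrite (surjective_pairing z) h1 h2 -surjective_pairing.
Qed.

Lemma ler_edist z w u v :
  (edist z w <= edist u v) = (edist z w ^+ 2 <= edist u v ^+ 2).
Proof. by rewrite ler_sqr// nnegrE edist_ge0. Qed.

Lemma edist_triangle u z w : edist z w <= edist z u + edist u w.
Proof.
have := sqr_edist z w; have := sqr_edist z u; have := sqr_edist u w.
have := edist_ge0 z w; have := edist_ge0 z u; have := edist_ge0 u w.
have -> : z.1 - w.1 = (z.1 - u.1) + (u.1 - w.1) by ring.
have -> : z.2 - w.2 = (z.2 - u.2) + (u.2 - w.2) by ring.
move: (edist u w) (edist z u) (edist z w) (z.1 - u.1) (z.2 - u.2) (u.1 - w.1)
  (u.2 - w.2) => q p r a c b d q0 p0 r0 eq ep er.
rewrite leNgt; apply/negP => lt.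
have h0 : (p + q) ^+ 2 < r ^+ 2 by rewrite ltr_pXn2r// nnegrE addr_ge0.
have h1 : p * q < a * b + c * d by nra.
have h2 : 0 <= p * q by rewrite mulr_ge0.
have h3 : (p * q) ^+ 2 = (a * b + c * d) ^+ 2 + (a * d - b * c) ^+ 2.
  by rewrite exprMn ep eq; ring.
have h4 := sqr_ge0 (a * d - b * c).
nra.
Qed.

Lemma edist_ge_coord z w : `|z.1 - w.1| <= edist z w /\ `|z.2 - w.2| <= edist z w.
Proof.
split; rewrite -sqrtr_sqr; apply: ler_wsqrtr; last by rewrite lerDr sqr_ge0.
by rewrite lerDl sqr_ge0.
Qed.

Lemma edist_le_coord z w (a b : R) :
  `|z.1 - w.1| <= a -> `|z.2 - w.2| <= b -> edist z w <= a + b.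
Proof.
move=> ha hb.
have a0 : 0 <= a by exact: le_trans ha.
have b0 : 0 <= b by exact: le_trans hb.
rewrite -(ger0_norm (addr_ge0 a0 b0)) -sqrtr_sqr; apply: ler_wsqrtr.
rewrite -(real_normK (num_real (z.1 - _))) -(real_normK (num_real (z.2 - _))).
have := normr_ge0 (z.1 - w.1); have := normr_ge0 (z.2 - w.2).
by nra.
Qed.

Lemma edist_segment c w z : segment c w z -> edist c z + edist z w = edist c w.
Proof.
move=> [t /andP[t0 t1] ->].
have scale (s a b a' b' : R) : 0 <= s -> a' = s * a -> b' = s * b ->
    Num.sqrt (a' ^+ 2 + b' ^+ 2) = s * Num.sqrt (a ^+ 2 + b ^+ 2).
  by move=> s0 -> ->; rewrite !exprMn -mulrDr sqrtrM ?sqr_ge0// sqrtr_sqr ger0_norm.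
rewrite /edist /=.
rewrite (scale t (c.1 - w.1) (c.2 - w.2) (c.1 - _)); [|by []|by ring|by ring].
rewrite (scale (1 - t) (c.1 - w.1) (c.2 - w.2) (_ + _ - w.1)); [|by lra|by ring|by ring].
by ring.
Qed.

Lemma common_side_nearest P v v' z u :
  P v -> P v' -> common_side P v v' z -> P u ->
  edist z v <= edist z u /\ edist z v' <= edist z u.
Proof.
suff near (y : R * R) : P y -> closure (voronoi_tile P y) z -> P u ->
    edist z y <= edist z u.
  by move=> Pv Pv' [cv cv'] Pu; split; apply: near.
move=> Py cl Pu; rewrite leNgt; apply/negP => lt.
pose e := (edist z y - edist z u) / 8.
have e0 : 0 < e by rewrite /e; lra.
have [z' [tz' zz']] := cl _ (nbhsx_ballx z e e0).
have dz : edist z z' <= e + e.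
  by case: zz' => /ltW b1 /ltW b2; apply: edist_le_coord.
have yu : u <> y by move=> uy; move: lt; rewrite uy ltxx.
have := tz' _ Pu yu.
have := edist_triangle z' z y; have := edist_triangle z z' u.
by rewrite (edistC z' z); rewrite /e in dz *; lra.
Qed.

(** Let [(x, y)] lead from the center of a circle to one of its points [v]. Then [v + e] and [v + f]
    are on the circle as well, and the three points lie on a line orthogonal to [d]; but a line
    meets a circle at most twice. *)
Lemma circles_parallel (d1 d2 e1 e2 f1 f2 x y : R) :
    d1 ^+ 2 + d2 ^+ 2 != 0 -> d1 * e1 + d2 * e2 = 0 -> d1 * f1 + d2 * f2 = 0 ->
    e1 ^+ 2 + e2 ^+ 2 + 2 * (e1 * x + e2 * y) = 0 ->
    f1 ^+ 2 + f2 ^+ 2 + 2 * (f1 * x + f2 * y) = 0 ->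
  [\/ e1 = 0 /\ e2 = 0, f1 = 0 /\ f2 = 0 | f1 = e1 /\ f2 = e2].
Proof.
move=> dn o1 o2 c1 c2.
have par : e1 * f2 = e2 * f1.
  apply/eqP; rewrite -subr_eq0 -(mulrI_eq0 _ (mulfI dn)).
  have -> : (d1 ^+ 2 + d2 ^+ 2) * (e1 * f2 - e2 * f1) =
    (d1 * f2 - d2 * f1) * (d1 * e1 + d2 * e2) -
    (d1 * e2 - d2 * e1) * (d1 * f1 + d2 * f2) by ring.
  by rewrite o1 o2 !mulr0 subrr.
pose m := e1 ^+ 2 + e2 ^+ 2; pose k := e1 * f1 + e2 * f2.
have [m0|m0] := eqVneq m 0.
  apply: Or31; move/eqP: m0; rewrite paddr_eq0 ?sqr_ge0// !sqrf_eq0.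
  by move=> /andP[/eqP -> /eqP ->].
have mf1 : m * f1 = k * e1.
  have -> : m * f1 = k * e1 - e2 * (e1 * f2 - e2 * f1) by rewrite /m /k; ring.
  by rewrite par subrr mulr0 subr0.
have mf2 : m * f2 = k * e2.
  have -> : m * f2 = k * e2 + e1 * (e1 * f2 - e2 * f1) by rewrite /m /k; ring.
  by rewrite par subrr mulr0 addr0.
(* Parallelism gives [m f = k e]. Once [k] is also the squared norm of [f], it must be 0 or [m],
   that is, [f = 0] or [f = e]. *)
have fk : f1 ^+ 2 + f2 ^+ 2 = k.
  apply: (mulfI m0).
  have c1' : 2 * (e1 * x + e2 * y) = - m by rewrite /m; lra.
  have -> : m * (f1 ^+ 2 + f2 ^+ 2) = m * (f1 ^+ 2 + f2 ^+ 2 + 2 * (f1 * x + f2 * y)) -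
     2 * (m * f1 * x + m * f2 * y) by ring.
  rewrite c2 mulr0 sub0r mf1 mf2.
  have -> : 2 * (k * e1 * x + k * e2 * y) = k * (2 * (e1 * x + e2 * y)) by ring.
  by rewrite c1'; ring.
have kk : k * (k - m) = 0.
  have -> : k * (k - m) = k ^+ 2 - m * k by ring.
  rewrite -{2}fk.
  have -> : m * (f1 ^+ 2 + f2 ^+ 2) = (m * f1) * f1 + (m * f2) * f2 by ring.
  by rewrite mf1 mf2 /k; ring.
move/eqP: kk; rewrite mulf_eq0 subr_eq0 => /orP[/eqP k0|/eqP km].
  apply: Or32; move/eqP: fk; rewrite k0 paddr_eq0 ?sqr_ge0// !sqrf_eq0.
  by move=> /andP[/eqP -> /eqP ->].
by apply: Or33; split; apply: (mulfI m0); rewrite ?mf1 ?mf2 km.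
Qed.

Lemma equidistant_two a b u v v' : a <> b -> v <> v' ->
    edist a v = edist a u -> edist a v' = edist a u ->
    edist b v = edist b u -> edist b v' = edist b u ->
  u = v \/ u = v'.
Proof.
move=> ab vv' h1 h2 h3 h4.
have {}h1 : edist a v ^+ 2 = edist a u ^+ 2 by rewrite h1.
have {}h2 : edist a v' ^+ 2 = edist a u ^+ 2 by rewrite h2.
have {}h3 : edist b v ^+ 2 = edist b u ^+ 2 by rewrite h3.
have {}h4 : edist b v' ^+ 2 = edist b u ^+ 2 by rewrite h4.
rewrite !sqr_edist in h1 h2 h3 h4.
case: a b u v v' ab vv' h1 h2 h3 h4 => [a1 a2] [b1 b2] [u1 u2] [v1 v2] [w1 w2] /=.
move=> ab vv' h1 h2 h3 h4.
have dn : (b1 - a1) ^+ 2 + (b2 - a2) ^+ 2 != 0.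
  rewrite paddr_eq0 ?sqr_ge0// !sqrf_eq0 !subr_eq0; apply/negP => /andP[/eqP e1 /eqP e2].
  by apply: ab; rewrite e1 e2.
have [||||[e1 e2]|[e1 e2]|[e1 e2]] :=
  circles_parallel (e1 := u1 - v1) (e2 := u2 - v2) (f1 := w1 - v1) (f2 := w2 - v2)
    (x := v1 - a1) (y := v2 - a2) dn.
- by lra.
- by lra.
- by lra.
- by lra.
- by left; congr (_, _); lra.
- by case: vv'; congr (_, _); lra.
- by right; congr (_, _); lra.
Qed.

Lemma segment_left a b : segment a b a.
Proof. by exists 0; rewrite ?lexx ?ler01// subr0 !mul1r !mul0r !addr0 -surjective_pairing. Qed.

Lemma segment_right a b : segment a b b.
Proof. by exists 1; rewrite ?lexx ?ler01// subrr !mul1r !mul0r !add0r -surjective_pairing. Qed.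

(** The center is the midpoint of a segment of the common side. For a third point [u], the
    difference of the squared distances to [u] and to [v] is affine and nonnegative along that
    segment. If it vanished at the midpoint it would vanish at both ends, and circles with distinct
    centers would share three points. No general position is assumed. *)
Lemma delaunay_circle P v v' : delaunay P v v' ->
  exists c, edist c v = edist c v' /\
    forall u, P u -> u <> v -> u <> v' -> edist c v < edist c u.
Proof.
move=> [Pv Pv' vv' [a [b [ab sab]]]].
pose c : R * R := ((1 - 1 / 2) * a.1 + 1 / 2 * b.1, (1 - 1 / 2) * a.2 + 1 / 2 * b.2).
have sc : segment a b c by exists (1 / 2) => //; apply/andP; split; lra.
have near z u : segment a b z -> P u -> edist z v <= edist z u /\ edist z v' <= edist z u.
  by move=> /sab sz; exact: common_side_nearest Pv Pv' sz.
have eqd z : segment a b z -> edist z v = edist z v'.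
  by move=> sz; apply/eqP; rewrite eq_le (near _ _ sz Pv').1 (near _ _ sz Pv).2.
exists c; split; first exact: eqd.
move=> u Pu uv uv'.
have [le _] := near _ _ sc Pu.
rewrite lt_neqAle le andbT; apply/eqP => cuv.
have sa := segment_left a b; have sb := segment_right a b.
have mid w : (edist c w ^+ 2 - edist c v ^+ 2) * 2 =
    (edist a w ^+ 2 - edist a v ^+ 2) + (edist b w ^+ 2 - edist b v ^+ 2).
  by rewrite !sqr_edist /=; field.
have ha : 0 <= edist a u ^+ 2 - edist a v ^+ 2.
  by rewrite subr_ge0 -ler_edist; have [] := near _ _ sa Pu.
have hb : 0 <= edist b u ^+ 2 - edist b v ^+ 2.
  by rewrite subr_ge0 -ler_edist; have [] := near _ _ sb Pu.
have := mid u; rewrite cuv subrr mul0r => h.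
have au : edist a v = edist a u.
  by apply/eqP; rewrite eq_le (near _ _ sa Pu).1 ler_edist; lra.
have bu : edist b v = edist b u.
  by apply/eqP; rewrite eq_le (near _ _ sb Pu).1 ler_edist; lra.
by have [] := equidistant_two ab vv' au (etrans (esym (eqd _ sa)) au)
  bu (etrans (esym (eqd _ sb)) bu).
Qed.

Lemma finite_gap P (f : R * R -> R) (r : R) : finite_set P ->
  (forall u, P u -> r < f u) -> exists2 r', r < r' & forall u, P u -> r' < f u.
Proof.
move=> /finite_seqP[s ->]; elim: s => [|x s IH] H.
  by exists (r + 1); [lra|move=> u; rewrite /= in_nil].
have [|r1 rr1 Hr1] := IH; first by move=> u us; apply: H; rewrite /= in_cons [_ \in s]us orbT.
have rx : r < f x by apply: H; rewrite /= in_cons eqxx.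
exists (Num.min r1 ((r + f x) / 2)); first by rewrite lt_min rr1; lra.
move=> u /=; rewrite in_cons => /orP[/eqP->|us].
  by rewrite gt_min; apply/orP; right; lra.
by rewrite gt_min Hr1.
Qed.

Lemma bounded_disc c (r : R) : bounded_set [set z | edist c z <= r].
Proof.
exists (`|c.1| + `|c.2| + r); split; first exact: num_real.
move=> M HM z /= hz; have [h1 h2] := edist_ge_coord c z.
apply: le_trans (ltW HM).
have -> : `|z| = Num.max `|z.1| `|z.2| by [].
rewrite ge_max; apply/andP; split.
  have := normr_ge0 c.2; have := ler_normB c.1 (c.1 - z.1); rewrite subKr; lra.
have := normr_ge0 c.1; have := ler_normB c.2 (c.2 - z.2); rewrite subKr; lra.
Qed.

Lemma delaunay_disc P v v' :
    (forall A, bounded_set A -> finite_set (P `&` A)) -> delaunay P v v' ->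
  exists c r1 r2, [/\ r1 < r2, edist c v <= r1, edist c v' <= r1 &
    forall u, P u -> u <> v -> u <> v' -> r2 < edist c u].
Proof.
move=> lfP /delaunay_circle[c [cv H]].
have fF : finite_set [set u |
    (P `&` [set z | (edist c z <= edist c v + 1)%R]) u /\ u <> v /\ u <> v'].
  by apply: sub_finite_set (lfP _ (@bounded_disc c (edist c v + 1))) => u [].
have [|r2 r12 Hr2] := finite_gap (f := edist c) (r := edist c v) fF.
  by move=> u [[Pu _] [uv uv']]; exact: H.
(* [r2] only controls the finitely many points within [edist c v + 1] of [c], hence the cap. *)
exists c, (edist c v), (Num.min r2 (edist c v + 1)); split.
- by rewrite lt_min r12; lra.
- by [].
- by rewrite cv.
- move=> u Pu uv uv'; rewrite gt_min.
  have [le|lt] := leP (edist c u) (edist c v + 1); last by apply/orP; right.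
  by rewrite Hr2.
Qed.

End plane.

(** * Discretization *)

Section cells.
Context {R : realType}.
Implicit Types (u v w z c : R * R) (n : nat).

Definition mesh n : R := n.+1%:R^-1.

Lemma mesh_gt0 n : 0 < mesh n. Proof. by rewrite invr_gt0. Qed.

Lemma mesh_small (e : R) : 0 < e -> exists m, forall n, (m <= n)%N -> mesh n < e.
Proof.
move=> e0; have /cvgrPdist_lt /(_ _ e0) [m _ H] := @cvg_harmonic R.
exists m => n mn; have := H n mn.
by rewrite sub0r normrN /= ger0_norm// invr_ge0.
Qed.

Definition cell_of n z : int * int :=
  (Num.floor (n.+1%:R * z.1), Num.floor (n.+1%:R * z.2)).

Definition cell_center n (a : int * int) : R * R :=
  ((a.1%:~R + 2^-1) * mesh n, (a.2%:~R + 2^-1) * mesh n).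

Lemma floor_center n (r : R) :
  `|r - ((Num.floor (n.+1%:R * r))%:~R + 2^-1) * mesh n| <= 2^-1 * mesh n.
Proof.
have n0 : 0 < n.+1%:R :> R by rewrite ltr0n.
have := floor_le (n.+1%:R * r); have := floorD1_gt (n.+1%:R * r).
rewrite intrD; move: (_%:~R) => k h1 h2.
have -> : r = (n.+1%:R * r) * mesh n by rewrite mulrAC mulfV ?mul1r// gt_eqF.
rewrite -mulrBl normrM (gtr0_norm (mesh_gt0 n)) ler_pM2r ?mesh_gt0//.
by rewrite ler_norml; apply/andP; split; lra.
Qed.

Lemma edist_center n z : edist z (cell_center n (cell_of n z)) <= mesh n.
Proof.
have -> : mesh n = 2^-1 * mesh n + 2^-1 * mesh n by lra.
by apply: edist_le_coord; exact: floor_center.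
Qed.

Lemma edist_same_cell n z w : cell_of n z = cell_of n w -> edist z w <= 2 * mesh n.
Proof.
move=> zw; have := edist_triangle (cell_center n (cell_of n z)) z w.
have := edist_center n z; have := edist_center n w.
by rewrite zw (edistC w); lra.
Qed.

(* Only the cells of a finite window, which exhausts the plane as n grows,
   are observed. *)
Definition window n : finType := ('I_(2 * n.+1 ^ 2) * 'I_(2 * n.+1 ^ 2))%type.

Definition window_cell n (k : window n) : int * int :=
  ((k.1 : int) - (n.+1 ^ 2)%N%:Z, (k.2 : int) - (n.+1 ^ 2)%N%:Z).

Lemma window_cell_inj n : injective (@window_cell n).
Proof.
move=> [k1 k2] [l1 l2] [/addIr/eqP h1 /addIr/eqP h2].
by congr (_, _); apply/val_inj/eqP.
Qed.

(** At mesh [1 / n.+1], indices between plus and minus [n.+1 ^ 2] reach up to coordinates of size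
    [n.+1]. *)
Lemma floor_window n (r b : R) : `|r| <= b -> b < n.+1%:R ->
  exists k : 'I_(2 * n.+1 ^ 2), Num.floor (n.+1%:R * r) = (k : int) - (n.+1 ^ 2)%N%:Z.
Proof.
move=> rb bn; have n0 : 0 < n.+1%:R :> R by rewrite ltr0n.
pose N := n.+1; have r_lt : `|N%:R * r| < N%:R * N%:R.
  by rewrite normrM ger0_norm// ltr_pM2l//; exact: le_lt_trans bn.
set f := Num.floor _.
have f1 : - (N ^ 2)%N%:Z <= f.
  rewrite /f floor_ge_int intrN -pmulrn natrX expr2.
  by move: r_lt; rewrite ltr_norml => /andP[/ltW].
have f2 : f < (N ^ 2)%N%:Z.
  rewrite /f floor_lt_int -pmulrn natrX expr2.
  by move: r_lt; rewrite ltr_norml => /andP[].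
have fn : (`|(f + (N ^ 2)%N%:Z)%R|%N < 2 * N ^ 2)%N by lia.
exists (Ordinal fn) => /=; lia.
Qed.

Lemma cell_of_window n z (b : R) : `|z.1| <= b -> `|z.2| <= b -> b < n.+1%:R ->
  exists k : window n, cell_of n z = window_cell k.
Proof.
move=> z1 z2 bn; have [k1 e1] := floor_window z1 bn; have [k2 e2] := floor_window z2 bn.
by exists (k1, k2); rewrite /cell_of e1 e2.
Qed.

(* [None], [Some true] and [Some false] stand for no point, one point and more. *)
Definition occupation n (x : nat -> R * R) : {ffun window n -> option bool} :=
  [ffun k => if `[< forall i, cell_of n (x i) <> window_cell k >] then None else
    Some `[< exists i, cell_of n (x i) = window_cell k /\
      forall j, cell_of n (x j) = window_cell k -> j = i >]].

Lemma occupation_None n x k : occupation n x k = None <->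
  forall i, cell_of n (x i) <> window_cell k.
Proof. by rewrite ffunE; case: asboolP. Qed.

Lemma occupation_single n x k : occupation n x k = Some true <->
  exists i, cell_of n (x i) = window_cell k /\
      forall j, cell_of n (x j) = window_cell k -> j = i.
Proof.
rewrite ffunE; case: asboolP => [H|H]; first by split => // -[i [/H]].
by split => [[/asboolP]|/asboolP ->].
Qed.

(* A disc of center c witnesses that the points in the cells a and b are
   Delaunay neighbours; the margin makes every point of the segment from c to
   the center of a closer to one of these two points than to any other. *)
Definition linked n (t : {ffun window n -> option bool}) (a b : window n) c :=
  exists r : R, [/\ a <> b, t a = Some true /\ t b = Some true,
    edist c (cell_center n (window_cell a)) + mesh n <= r,
    edist c (cell_center n (window_cell b)) + mesh n <= r &
    forall z, edist c z <= r ->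
      exists2 k, cell_of n z = window_cell k & [\/ k = a, k = b | t k = None]].

(** Each link contributes only the half from the disc center to the first cell; the other half comes
    from the swapped pair, through [linked_sym]. *)
Definition region n t (o : window n -> window n -> bool) : set (R * R) :=
  [set z | exists a b c, [/\ o a b, linked t a b c &
    segment c (cell_center n (window_cell a)) z]].

Lemma linked_sym n (t : {ffun window n -> option bool}) a b c :
  linked t a b c -> linked t b a c.
Proof.
move=> [r [ab [ta tb] ha hb H]]; exists r; split => //; first by move=> e; apply: ab.
by move=> z /H[k zk [kab|kab|tk]]; exists k => //; [apply: Or32|apply: Or31|apply: Or33].
Qed.

(** A point nearest to [z] is at least as near as [x i], so following the segment from [c] through
    [z] bounds its distance to [c] by that of the center of [a] plus one mesh, hence by [r]. It lies
    in the witnessing disc, whose occupied cells are [a] and [b]. *)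
Lemma region_nearest n x o z : region (occupation n x) o z ->
  exists a b i j, [/\ o a b, occupation n x a = Some true, occupation n x b = Some true,
    cell_of n (x i) = window_cell a /\ cell_of n (x j) = window_cell b &
    forall k, (forall l, edist z (x k) <= edist z (x l)) -> k = i \/ k = j].
Proof.
move=> [a [b [c [oab [r [ab [ta tb] ha _ H]] sz]]]].
have /occupation_single[i [ia iu]] := ta; have /occupation_single[j [jb ju]] := tb.
exists a, b, i, j; split => // k kmin.
have kr : edist c (x k) <= r.
  have := edist_triangle z c (x k); have := kmin i.
  have := edist_triangle (cell_center n (window_cell a)) z (x i).
  have := edist_segment sz; have := edist_center n (x i).
  by rewrite ia (edistC (x i)); lra.
have [k' kk' [k'a|k'b|/occupation_None Hk]] := H _ kr.
- by left; apply: iu; rewrite kk' k'a.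
- by right; apply: ju; rewrite kk' k'b.
- by case: (Hk k).
Qed.

Lemma linked_eventually (x : nat -> R * R) i j c (r1 r2 : R) : injective x -> i <> j ->
    r1 < r2 -> edist c (x i) <= r1 -> edist c (x j) <= r1 ->
    (forall k, k <> i -> k <> j -> r2 < edist c (x k)) ->
  exists m, forall n, (m <= n)%N -> exists a b : window n,
    [/\ cell_of n (x i) = window_cell a, cell_of n (x j) = window_cell b,
      occupation n x a = Some true, occupation n x b = Some true &
      linked (occupation n x) a b c].
Proof.
move=> xinj ij r12 ci cj H.
have dij : 0 < edist (x i) (x j).
  rewrite lt_neqAle edist_ge0 andbT; apply/eqP => /esym/edist_eq0/xinj; exact: ij.
(* Four meshes fit between [r1] and [r2]: two make room for the cell centers in the radius
   [r1 + 2 * mesh n], two keep every cell met by that disc within distance [r2]. The second bound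
   puts [x i] and [x j] in different cells. *)
pose e := Num.min ((r2 - r1) / 4) (edist (x i) (x j) / 2).
have e0 : 0 < e by rewrite lt_min; apply/andP; split; lra.
have [m1 Hm1] := mesh_small e0.
pose b := `|c.1| + `|c.2| + r2.
exists (maxn m1 (Num.bound b)) => n.
rewrite geq_max => /andP[/Hm1 + bn].
rewrite lt_min => /andP[n1 n2].
have m0 := mesh_gt0 n.
have r2_ge0 : 0 <= r2 by have := edist_ge0 c (x i); lra.
have win z : edist c z <= r2 -> exists k : window n, cell_of n z = window_cell k.
  move=> cz; have [c1 c2] := edist_ge_coord c z.
  apply: (@cell_of_window _ _ b).
  - have := normr_ge0 c.2; have := ler_normB c.1 (c.1 - z.1); rewrite subKr /b; lra.
  - have := normr_ge0 c.1; have := ler_normB c.2 (c.2 - z.2); rewrite subKr /b; lra.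
  - apply: (@lt_le_trans _ _ (Num.bound b)%:R); last by rewrite ler_nat ltnW// ltnS.
    by apply: archi_boundP; rewrite /b !addr_ge0.
have [|a ia] := win (x i); first by lra.
have [|a' ja'] := win (x j); first by lra.
have only k z : edist c z <= r2 - 2 * mesh n -> cell_of n (x k) = cell_of n z ->
    k = i \/ k = j.
  move=> cz kz; have [->|ki] := pselect (k = i); first by left.
  have [->|kj] := pselect (k = j); first by right.
  exfalso; have := H k ki kj; have := edist_triangle z c (x k).
  by have := edist_same_cell kz; rewrite (edistC (x k)); lra.
have diff : cell_of n (x i) <> cell_of n (x j).
  by move=> /edist_same_cell; lra.
have sa : occupation n x a = Some true.
  apply/occupation_single; exists i; split => // k; rewrite -ia => ki.
  have [|//|] := only k (x i) _ ki; first by lra.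
  by move=> kj; case: diff; rewrite -kj ki.
have sa' : occupation n x a' = Some true.
  apply/occupation_single; exists j; split => // k; rewrite -ja' => kj.
  have [||//] := only k (x j) _ kj; first by lra.
  by move=> ki; case: diff; rewrite -ki kj.
exists a, a'; split => //.
exists (r1 + 2 * mesh n); split => //.
- by move=> aa'; apply: diff; rewrite ia ja' aa'.
- have := edist_triangle (x i) c (cell_center n (window_cell a)).
  by have := edist_center n (x i); rewrite ia; lra.
- have := edist_triangle (x j) c (cell_center n (window_cell a')).
  by have := edist_center n (x j); rewrite ja'; lra.
- move=> z cz; have [|k zk] := win z; first by lra.
  exists k => //.
  have [ka|ka] := pselect (k = a); first by apply: Or31.
  have [kb|kb] := pselect (k = a'); first by apply: Or32.
  apply: Or33; apply/occupation_None => l lk.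
  have [||li|lj] := only l z; [by lra|by rewrite zk|..].
    by apply: ka; apply: window_cell_inj; rewrite -lk li ia.
  by apply: kb; apply: window_cell_inj; rewrite -lk lj ja'.
Qed.

End cells.

(** * Crossing events of the discretized configuration *)

Section crossing_event.
Context {R : realType}.
Implicit Types (u v w z c : R * R) (n l : nat) (x : nat -> R * R)
  (s : nat * nat -> bool).

(** Read only at singly occupied cells, where the choice is forced; elsewhere the value is
    arbitrary. *)
Definition labels n x : {ffun window n -> nat} :=
  [ffun k => xget 0%N [set i | cell_of n (x i) = window_cell k]].

(* The unordered pairs of singly occupied cells get the label of the edge
   between their points; the other pairs get distinct labels (i, 0) with 0 < i,
   which never occur as labels of edges. *)
Definition edge_label n (t : {ffun window n -> option bool})
    (lab : {ffun window n -> nat}) (ab : window n * window n) : nat * nat :=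
  if [&& t ab.1 == Some true, t ab.2 == Some true &
      (enum_rank ab.1 < enum_rank ab.2)%N]
  then (minn (lab ab.1) (lab ab.2), maxn (lab ab.1) (lab ab.2))
  else ((enum_rank ab).+1, 0%N).

(** The state of an unordered pair is stored at the ordering with increasing ranks, the one to which
    [edge_label] gives the label of an edge. *)
Definition edge_open n (e : {ffun window n * window n -> bool}) (a b : window n) :=
  if (enum_rank a < enum_rank b)%N then e (a, b) else e (b, a).

Definition edge_states n x s : {ffun window n * window n -> bool} :=
  [ffun ab => s (edge_label (occupation n x) (labels n x) ab)].

Definition open_region n x s : set (R * R) :=
  region (occupation n x) (edge_open (edge_states n x s)).

Definition vertical_crossing n l (t : {ffun window n -> option bool})
    (e : {ffun window n * window n -> bool}) : Prop :=
  exists z w : R * R, [/\ joined (region t (edge_open e) `&`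
    box 0 (6 * l%:R) 0 (2 * l%:R)) z w, z.2 = 0 & w.2 = 2 * l%:R].

Definition crosses n l x s : Prop :=
  vertical_crossing l (occupation n x) (edge_states n x s).

Lemma labels_single n x k i : occupation n x k = Some true ->
  cell_of n (x i) = window_cell k -> labels n x k = i.
Proof.
move=> /occupation_single[j [kj ju]] ki.
rewrite ffunE; case: xgetP => [m _ /= mk|]; first by rewrite (ju _ mk) (ju _ ki).
by move=> /(_ i).
Qed.

Lemma edge_open_states n x s a b i j : a <> b ->
    occupation n x a = Some true -> occupation n x b = Some true ->
    cell_of n (x i) = window_cell a -> cell_of n (x j) = window_cell b ->
  edge_open (edge_states n x s) a b = s (minn i j, maxn i j).
Proof.
move=> ab sa sb ia jb; rewrite /edge_open /edge_states.
have la := labels_single sa ia; have lb := labels_single sb jb.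
have [lt|] := ltnP (enum_rank a) (enum_rank b).
  by rewrite ffunE /edge_label /= sa sb lt !eqxx /= la lb.
rewrite leq_eqVlt => /orP[/eqP/val_inj/enum_rank_inj ba|lt]; first by case: ab.
by rewrite ffunE /edge_label /= sa sb lt !eqxx /= la lb minnC maxnC.
Qed.

(** Distinct labels make the edge states a family of independent variables indexed by a fixed finite
    type, whose law does not depend on the points. *)
Lemma edge_label_inj n (t : {ffun window n -> option bool})
    (lab : {ffun window n -> nat}) :
  (forall a b, t a = Some true -> t b = Some true -> lab a = lab b -> a = b) ->
  injective (edge_label t lab).
Proof.
move=> labinj [a b] [a' b']; rewrite /edge_label /=.
case: ifP => [/and3P[/eqP ta /eqP tb ab]|_];
  case: ifP => [/and3P[/eqP ta' /eqP tb' ab']|_].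
- case=> hmin hmax.
  have : lab a = lab a' /\ lab b = lab b' \/ lab a = lab b' /\ lab b = lab a'.
    move: (lab a) (lab b) (lab a') (lab b') hmin hmax => {ta tb ta' tb' ab ab' labinj}.
    by move=> p q p' q'; lia.
  case=> -[h1 h2]; first by rewrite (labinj _ _ ta ta' h1) (labinj _ _ tb tb' h2).
  by move: ab ab'; rewrite (labinj _ _ ta tb' h1) (labinj _ _ tb ta' h2); lia.
- case=> h1 h2; have lab_ab : lab a = lab b by lia.
  by move: ab; rewrite (labinj _ _ ta tb lab_ab) ltnn.
- case=> h1 h2; have lab_ab : lab a' = lab b' by lia.
  by move: ab'; rewrite (labinj _ _ ta' tb' lab_ab) ltnn.
- by case=> /val_inj/enum_rank_inj.
Qed.

Lemma segment_sub (a b z w : R * R) : segment a b z -> segment a b w ->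
  segment z w `<=` segment a b.
Proof.
move=> [t1 /andP[? ?] ->] [t2 /andP[? ?] ->] _ [t /andP[? ?] ->] /=.
exists ((1 - t) * t1 + t * t2); first by apply/andP; split; nra.
by congr (_, _); ring.
Qed.

Lemma box_convex (x1 x2 y1 y2 : R) z w : box x1 x2 y1 y2 z -> box x1 x2 y1 y2 w ->
  segment z w `<=` box x1 x2 y1 y2.
Proof.
move=> [/andP[? ?] /andP[? ?]] [/andP[? ?] /andP[? ?]] _ [t /andP[? ?] ->].
by split => /=; apply/andP; split; nra.
Qed.

Lemma joined_box A (x1 x2 y1 y2 : R) a b z w : segment a b `<=` A ->
    segment a b z -> segment a b w -> box x1 x2 y1 y2 z -> box x1 x2 y1 y2 w ->
  joined (A `&` box x1 x2 y1 y2) z w.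
Proof.
move=> sA sz sw bz bw; apply: joined_segment => y zwy; split.
  exact/sA/(segment_sub sz sw).
exact: box_convex zwy.
Qed.

Definition voronoi_sides x s : set (R * R) :=
  [set z | exists i j, [/\ x i <> x j, common_side (range x) (x i) (x j) z &
    s (minn i j, maxn i j)]].

(** Only the first and the last edge may leave the rectangle. They are cut at [z] and [w], where
    they meet the two sides; convexity of the box keeps the rest inside. For [h = 2] both cuts are
    on the same edge. *)
Lemma crossing_joined (L : R) x s : 0 <= L -> crossing L x s ->
  exists z w, [/\ joined (voronoi_sides x s `&` box 0 (3 * L) 0 L) z w,
    z.1 = 0 & w.1 = 3 * L].
Proof.
move=> L0 [h [v [[h2 E _] [[z [sz [/= z0 zL]]] [w [sw [/= wL0 wL]]]] inbox]]].
have L30 : 0 <= 3 * L by rewrite mulr_ge0.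
rewrite in_itv /= in zL; rewrite in_itv /= in wL.
have sideE j : (1 <= j < h)%N -> segment (v j) (v j.+1) `<=` voronoi_sides x s.
  move=> /E[i1 [i2 [[[_ _ ne _] cs] si]]] y sy.
  by exists i1, i2; split => //; rewrite cs.
have bz : box 0 (3 * L) 0 L z by split => //; rewrite z0 lexx.
have bw : box 0 (3 * L) 0 L w by split => //; rewrite wL0 L30 lexx.
exists z, w; split => //.
have [h3|h3] := leqP 3 h; last first.
  have e2 : h = 2%N by apply/eqP; rewrite eqn_leq -ltnS h3.
  move: sw; rewrite e2 /= => sw; exact: joined_box (sideE 1%N _) sz sw bz bw.
have bv j : (2 <= j <= h.-1)%N -> box 0 (3 * L) 0 L (v j).
  by move=> /inbox[/=]; rewrite !in_itv.
have z2 : joined (voronoi_sides x s `&` box 0 (3 * L) 0 L) z (v 2%N).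
  by apply: joined_box (sideE 1%N _) sz (segment_right _ _) bz (bv _ _); lia.
have hw : joined (voronoi_sides x s `&` box 0 (3 * L) 0 L) (v h.-1) w.
  have hE : h.-1.+1 = h by rewrite prednK//; lia.
  apply: joined_box (segment_left _ _) sw (bv _ _) bw; last by lia.
  by have := sideE h.-1; rewrite hE; apply; lia.
apply: joined_trans z2 _; apply: joined_trans hw.
have mid m : (2 + m <= h.-1)%N ->
    joined (voronoi_sides x s `&` box 0 (3 * L) 0 L) (v 2%N) (v (2 + m)%N).
  elim: m => [|m IH] mh.
    rewrite addn0; apply: joined_box (sideE 2%N _) (segment_left _ _) (segment_left _ _) _ _.
    - by lia.
    - by apply: bv; lia.
    - by apply: bv; lia.
  rewrite addnS; apply: joined_trans (IH _) _; first by lia.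
  apply: joined_box (sideE (2 + m)%N _) (segment_left _ _) (segment_right _ _) _ _.
  - by lia.
  - by apply: bv; lia.
  - by apply: bv; lia.
by have := mid (h.-1 - 2)%N; rewrite subnKC; [apply|]; lia.
Qed.

(** On a common side both its points are nearest to [z], and on the region only the two linked
    points can be nearest. The two pairs coincide, so both edges read the same label. *)
Lemma open_region_voronoi n x s s' z : injective x ->
    open_region n x s z -> voronoi_sides x s' z ->
  exists ij, s ij && s' ij.
Proof.
move=> xinj /region_nearest[a [b [i [j [oab sa sb [ia jb] H]]]]].
move=> [k [l [kl cs sl]]].
have near m : edist z (x k) <= edist z (x m) /\ edist z (x l) <= edist z (x m).
  by apply: common_side_nearest cs _; [exists k|exists l|exists m].
have klN : k <> l by move=> e; apply: kl; rewrite e.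
have ab : a <> b.
  move=> ab; have /occupation_single[m [_ mu]] := sa.
  have ki : i = j by rewrite (mu i ia) (mu j)// ab.
  by have [] := H k (fun m => (near m).1); have [] := H l (fun m => (near m).2); congruence.
exists (minn k l, maxn k l); rewrite sl andbT.
rewrite (edge_open_states s ab sa sb ia jb) in oab.
have [ki|kj] := H k (fun m => (near m).1); have [li|lj] := H l (fun m => (near m).2).
- by case: klN; rewrite ki li.
- by rewrite ki lj.
- by rewrite kj li minnC maxnC.
- by case: klN; rewrite kj lj.
Qed.

Lemma crossing_crosses n l x s s' : injective x ->
  crossing (2 * l%:R) x s' -> crosses n l x s -> exists ij, s ij && s' ij.
Proof.
move=> xinj /crossing_joined[|z [w [zw z0 wl]]]; first by rewrite mulr_ge0.
move=> [z' [w' [zw' z0' wl']]].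
have L6 : 3 * (2 * l%:R) = 6 * l%:R :> R by rewrite mulrA -natrM.
rewrite L6 in zw wl.
have [y [vy oy]] := joined_crossing zw z0 wl zw' z0' wl'.
exact: open_region_voronoi oy vy.
Qed.

End crossing_event.

(** * Annuli *)

Section frames.
Context {R : realType}.
Implicit Types (u v w z c : R * R) (n l : nat) (x : nat -> R * R)
  (s : nat * nat -> bool) (f : bool * int * int).

Definition frame f z : R * R :=
  let: (sw, p, q) := f in
  if sw then (z.2 + p%:~R, z.1 + q%:~R) else (z.1 + p%:~R, z.2 + q%:~R).

Definition frame_cell n f (a : int * int) : int * int :=
  let: (sw, p, q) := f in
  if sw then (a.2 + n.+1%:Z * p, a.1 + n.+1%:Z * q)
  else (a.1 + n.+1%:Z * p, a.2 + n.+1%:Z * q).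

Lemma cell_of_frame n f z : cell_of n (frame f z) = frame_cell n f (cell_of n z).
Proof.
have shift (r : R) (p : int) :
    Num.floor (n.+1%:R * (r + p%:~R)) = Num.floor (n.+1%:R * r) + n.+1%:Z * p.
  have -> : n.+1%:R * (r + p%:~R) = n.+1%:R * r + (n.+1%:Z * p)%:~R.
    by rewrite mulrDr intrM.
  by rewrite floorDrz ?intr_int// intrKfloor.
by case: f => -[[] p] q; rewrite /cell_of /= !shift.
Qed.

Lemma cell_center_frame n f a :
  cell_center n (frame_cell n f a) = frame f (cell_center n a) :> R * R.
Proof.
have shift (k p : int) :
    ((k + n.+1%:Z * p)%:~R + 2^-1) * mesh n = (k%:~R + 2^-1) * mesh n + p%:~R :> R.
  rewrite intrD intrM addrAC mulrDl; congr (_ + _).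
  by rewrite mulrAC /mesh mulfV ?mul1r// pnatr_eq0.
by case: f => -[[] p] q; rewrite /cell_center /= !shift.
Qed.

Lemma edist_frame f z w : edist (frame f z) (frame f w) = edist z w.
Proof.
have shift (a b : R) (p : int) : a + p%:~R - (b + p%:~R) = a - b by ring.
by case: f => -[[] p] q; rewrite /edist /= !shift // addrC.
Qed.

Lemma frame_inj f : injective (frame f).
Proof.
by case: f => -[[] p] q [z1 z2] [w1 w2] /= [/addIr -> /addIr ->].
Qed.

Lemma segment_frame f z w y : segment z w y ->
  segment (frame f z) (frame f w) (frame f y).
Proof.
move=> [t t01 ->]; exists t => //.
by case: f => -[[] p] q /=; congr (_, _); ring.
Qed.

Lemma joined_frame f (A B : set (R * R)) z w : joined A z w ->
  (forall y, A y -> B (frame f y)) -> joined B (frame f z) (frame f w).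
Proof.
have shift (g : R -> R) (p : int) : continuous g -> continuous (fun t => g t + p%:~R).
  by move=> cg t; apply: cvgD; [exact: cg|exact: cvg_cst].
move=> [g [h [cg ch <- <- H]]] AB.
case: f AB => -[[] p] q AB /=.
  exists (fun t => h t + p%:~R), (fun t => g t + q%:~R).
  by split => //; [exact: shift|exact: shift|move=> t /H/AB].
exists (fun t => g t + p%:~R), (fun t => h t + q%:~R).
by split => //; [exact: shift|exact: shift|move=> t /H/AB].
Qed.

(* The isometries mapping the four rectangles around the square [-l, l]^2 that
   make up [-3l, 3l]^2 \ [-l, l]^2 to [0, 6l] * [0, 2l]. *)
Definition annulus_frames l : seq (bool * int * int) :=
  [seq (sw, (3 * l)%N%:Z, q) | sw <- [:: false; true], q <- [:: - l%:Z; (3 * l)%N%:Z]].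

(** The window is not invariant under the frames, so each frame discretizes the points in its own
    way. A path in the intersection serves whichever rectangle it turns out to cross. *)
Definition annulus_region n l x s : set (R * R) :=
  [set z | forall f, f \in annulus_frames l ->
    open_region n (frame f \o x) s (frame f z)].

Lemma annulus_region_crosses n l x s z w : (0 < l)%N ->
    joined (annulus_region n l x s) z w ->
    `|z.1| <= l%:R -> `|z.2| <= l%:R -> 3 * l%:R <= Num.max `|w.1| `|w.2| ->
  exists2 f, f \in annulus_frames l & crosses n l (frame f \o x) s.
Proof.
move=> l0 zw z1 z2 w12.
have l0' : 0 < l%:R :> R by rewrite ltr0n.
have l3 : (3 * l)%N%:~R = 3 * l%:R :> R by rewrite -pmulrn natrM.
have lN : (- l%:Z)%:~R = - l%:R :> R by rewrite intrN -pmulrn.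
have use f (D : set (R * R)) z' w' : f \in annulus_frames l ->
    joined (annulus_region n l x s `&` D) z' w' ->
    (forall y, D y -> box 0 (6 * l%:R) 0 (2 * l%:R) (frame f y)) ->
    (frame f z').2 = 0 -> (frame f w').2 = 2 * l%:R ->
    exists2 f, f \in annulus_frames l & crosses n l (frame f \o x) s.
  move=> fl zw' Dbox z'0 w'l; exists f => //; exists (frame f z'), (frame f w').
  by split => //; apply: joined_frame zw' _ => y [/(_ _ fl) ? /Dbox].
have [] := annulus_crossing l0' zw z1 z2 w12 => -[z' [w' [zw' z'l w'l]]].
- apply: (use (false, (3 * l)%N%:Z, - l%:Z) _ _ _ _ zw');
    rewrite ?inE ?eqxx ?orbT// /= ?l3 ?lN; [|by lra|by lra].
  by move=> y [/andP[? ?] /andP[? ?]]; split; rewrite /= ?l3 ?lN; apply/andP; split; lra.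
- apply: (use (false, (3 * l)%N%:Z, (3 * l)%N%:Z) _ _ _ _ zw');
    rewrite ?inE ?eqxx ?orbT// /= ?l3 ?lN; [|by lra|by lra].
  by move=> y [/andP[? ?] /andP[? ?]]; split; rewrite /= ?l3 ?lN; apply/andP; split; lra.
- apply: (use (true, (3 * l)%N%:Z, - l%:Z) _ _ _ _ zw');
    rewrite ?inE ?eqxx ?orbT// /= ?l3 ?lN; [|by lra|by lra].
  by move=> y [/andP[? ?] /andP[? ?]]; split; rewrite /= ?l3 ?lN; apply/andP; split; lra.
- apply: (use (true, (3 * l)%N%:Z, (3 * l)%N%:Z) _ _ _ _ zw');
    rewrite ?inE ?eqxx ?orbT// /= ?l3 ?lN; [|by lra|by lra].
  by move=> y [/andP[? ?] /andP[? ?]]; split; rewrite /= ?l3 ?lN; apply/andP; split; lra.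
Qed.

Definition locally_finite x :=
  forall A : set (R * R), bounded_set A -> finite_set (range x `&` A).

Definition tile_center n z : R * R := cell_center n (cell_of n z).

Lemma tile_center_frame n f z : tile_center n (frame f z) = frame f (tile_center n z).
Proof. by rewrite /tile_center cell_of_frame cell_center_frame. Qed.

Lemma eventually_seq (T : eqType) (F : seq T) (P : T -> nat -> Prop) :
  (forall a : T, a \in F -> exists m, forall n, (m <= n)%N -> P a n) ->
  exists m, forall n, (m <= n)%N -> forall a : T, a \in F -> P a n.
Proof.
elim: F => [|a F IH] H; first by exists 0%N.
have [|m1 H1] := IH; first by move=> b bF; apply: H; rewrite in_cons bF orbT.
have [m2 H2] := H a (mem_head _ _).
exists (maxn m1 m2) => n; rewrite geq_max => /andP[n1 n2] b.
by rewrite in_cons => /orP[/eqP->|]; [exact: H2|exact: H1].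
Qed.

Lemma delaunay_open_joined l x s u v : injective x -> locally_finite x ->
  delaunay_open x s u v -> exists m, forall n, (m <= n)%N ->
    joined (annulus_region n l x s) (tile_center n u) (tile_center n v).
Proof.
move=> xinj lfx [i [j [-> -> D sij]]].
have [c [r1 [r2 [r12 ci cj H]]]] := delaunay_disc lfx D.
have ij : i <> j by move=> e; case: D => _ _ + _; rewrite e.
have [m Hm] : exists m, forall n, (m <= n)%N -> forall f, f \in annulus_frames l ->
    segment (frame f c) (frame f (tile_center n (x i))) `<=` open_region n (frame f \o x) s /\
    segment (frame f c) (frame f (tile_center n (x j))) `<=` open_region n (frame f \o x) s.
  apply: eventually_seq => f _.
  have [|||k ki kj|m Hm] := @linked_eventually _ (frame f \o x) i j (frame f c) r1 r2 _ ij r12.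
  - by move=> a b /= /frame_inj/xinj.
  - by rewrite /= edist_frame.
  - by rewrite /= edist_frame.
  - rewrite /= edist_frame; apply: H; first by exists k.
      by move=> /xinj.
    by move=> /xinj.
  exists m => n /Hm[a [b [ia jb sa sb lnk]]].
  have ab : a <> b by case: lnk => ? [].
  have oab := edge_open_states s ab sa sb ia jb.
  have oba := edge_open_states s (fun e => ab (esym e)) sb sa jb ia.
  rewrite -!tile_center_frame /tile_center -/((frame f \o x) i) -/((frame f \o x) j) ia jb.
  split => z sz; first by exists a, b, (frame f c); rewrite oab.
  by exists b, a, (frame f c); split => //; [rewrite oba minnC maxnC|exact: linked_sym].
(* The center [c] does not depend on the frame or on the mesh, so a single broken line through it
   lies in all four regions. *)
exists m => n mn; apply: (@joined_trans _ _ _ c).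
  apply/joined_sym/joined_segment => z sz f fl.
  by apply: (Hm _ mn _ fl).1; exact: segment_frame.
apply: joined_segment => z sz f fl.
by apply: (Hm _ mn _ fl).2; exact: segment_frame.
Qed.

(** The alternative [u = v] is kept because the constant path at a cell center need not lie in the
    region. *)
Lemma cluster_joined l x s u v : injective x -> locally_finite x ->
  open_cluster x s u v -> exists m, forall n, (m <= n)%N -> u = v \/
    joined (annulus_region n l x s) (tile_center n u) (tile_center n v).
Proof.
move=> xinj lfx; rewrite /open_cluster /=; elim => {u v}.
- move=> u v /(delaunay_open_joined l xinj lfx)[m H].
  by exists m => n /H; right.
- by move=> u; exists 0%N => n _; left.
- move=> u w v _ [m1 H1] _ [m2 H2]; exists (maxn m1 m2) => n.
  rewrite geq_max => /andP[/H1 uw /H2 wv].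
  case: uw wv => [-> //|uw] [<-|wv]; first by right.
  by right; exact: joined_trans wv.
Qed.

Lemma open_cluster_range x s i v : open_cluster x s (x i) v -> range x v.
Proof.
have H u w : clos_refl_trans (R * R)%type (delaunay_open x s) u w -> range x u -> range x w.
  elim => {u w} [u w [_ [j [_ -> _ _]]] _|//|u w y _ uw _ wy /uw/wy//].
  by exists j.
by move=> /H; apply; exists i.
Qed.

Lemma infinite_cluster_far x s i (r : R) : locally_finite x ->
    infinite_set (open_cluster x s (x i)) ->
  exists2 v, open_cluster x s (x i) v & r < Num.max `|v.1| `|v.2|.
Proof.
move=> lfx inf; apply: contrapT => H; apply: inf.
apply: sub_finite_set (lfx [set z | `|z| <= r] _); last first.
  by exists r; split; [exact: num_real|move=> M rM z /= zr; exact: le_trans (ltW rM)].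
move=> v xv; split; first exact: open_cluster_range xv.
by rewrite /= leNgt; apply/negP => rv; apply: H; exists v.
Qed.

(** Once the square contains a point of the infinite cluster, that point is connected to another one
    beyond the annulus by finitely many edges, and one mesh is fine enough for all of them. *)
Lemma percolates_crosses x s : injective x -> locally_finite x -> percolates x s ->
  exists m, forall l, (m <= l)%N -> exists m', forall n, (m' <= n)%N ->
    exists2 f, f \in annulus_frames l & crosses n l (frame f \o x) s.
Proof.
move=> xinj lfx [i inf].
have ctr n z : `|(tile_center n z).1| <= `|z.1| + 1 /\ `|(tile_center n z).2| <= `|z.2| + 1 /\
    `|z.1| <= `|(tile_center n z).1| + 1 /\ `|z.2| <= `|(tile_center n z).2| + 1.
  have [] := edist_ge_coord z (tile_center n z).
  have := edist_center n z; rewrite -/(tile_center n z).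
  have : mesh n <= 1 :> R by rewrite invf_le1// ler1n.
  move: (edist _ _) (mesh n) => e m m1 em h1 h2.
  have := ler_normB z.1 (z.1 - (tile_center n z).1); rewrite subKr.
  have := ler_normB z.2 (z.2 - (tile_center n z).2); rewrite subKr.
  have := ler_normD (tile_center n z).1 (z.1 - (tile_center n z).1); rewrite subrKC.
  have := ler_normD (tile_center n z).2 (z.2 - (tile_center n z).2); rewrite subrKC.
  by lra.
(* The term 1, here and in [3 * l%:R + 1], absorbs the displacement from a point to the center of
   its cell. *)
pose b := `|(x i).1| + `|(x i).2| + 1.
exists (Num.bound b) => l bl.
have lb : b < l%:R.
  apply: (@lt_le_trans _ _ (Num.bound b)%:R); last by rewrite ler_nat.
  by apply: archi_boundP; rewrite /b !addr_ge0.
have l0 : (0 < l)%N by rewrite -(ltr_nat R); apply: le_lt_trans lb; rewrite /b !addr_ge0.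
have [v xv far] := infinite_cluster_far (3 * l%:R + 1) lfx inf.
have [m Hm] := cluster_joined l xinj lfx xv.
exists m => n /Hm[xiv|zw].
  move: far; rewrite -xiv lt_max /= => /orP; move: lb; rewrite /b.
  have := normr_ge0 (x i).1; have := normr_ge0 (x i).2.
  by move=> h1 h2 h3 [] h4; exfalso; clear xiv; lra.
apply: annulus_region_crosses zw _ _ _ => //.
- have [h1 _] := ctr n (x i); have := normr_ge0 (x i).2.
  by rewrite /b in lb; lra.
- have [_ [h1 _]] := ctr n (x i); have := normr_ge0 (x i).1.
  by rewrite /b in lb; lra.
- have [_ [_ [h1 h2]]] := ctr n v.
  move: far; rewrite lt_max le_max => /orP[h3|h3]; apply/orP; [left|right]; lra.
Qed.

End frames.

(** * Independent edge states *)

Section finite_laws.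
Context {d : measure_display} {T : measurableType d} {R : realType}.

Lemma bigcup_finType (I : finType) (P : pred I) (F : I -> set T) :
  \bigcup_(i in [set i | P i]) F i = \bigcup_(i in [set` enum P]) F i.
Proof. by apply: eq_bigcupl; split => i /=; rewrite mem_enum. Qed.

Lemma measurable_bigcup_finType (I : finType) (P : pred I) (F : I -> set T) :
  (forall i, measurable (F i)) -> measurable (\bigcup_(i in [set i | P i]) F i).
Proof.
move=> mF; rewrite bigcup_finType; exact: fin_bigcup_measurable.
Qed.

Lemma measure_bigcup_finType (mu : {measure set T -> \bar R}) (I : finType)
    (P : pred I) (F : I -> set T) : (forall i, measurable (F i)) ->
    trivIset setT F ->
  mu (\bigcup_(i in [set i | P i]) F i) = (\sum_(i | P i) mu (F i))%E.
Proof.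
move=> mF tF; rewrite bigcup_finType measure_fin_bigcup//.
- by rewrite -fsbig_seq ?enum_uniq// big_enum.
- exact: sub_trivIset tF.
Qed.

Lemma independent_finType {d'} {T' : measurableType d'} (Q : probability T R)
    (J : choiceType) (Y : J -> T -> T') (I : finType) (g : I -> J) (B : I -> set T') :
    mutually_independent Q Y -> injective g -> (forall k, measurable (B k)) ->
  Q [set e | forall k, B k (Y (g k) e)] = (\prod_k Q (Y (g k) @^-1` B k))%E.
Proof.
move=> ind ginj mB.
pose F : {fset J} := [fset g k | k in I]%fset.
pose C j := if [pick k | g k == j] is Some k then B k else setT.
have Cg k : C (g k) = B k.
  by rewrite /C; case: pickP => [k' /eqP/ginj->//|/(_ k)]; rewrite eqxx.
have mC j : measurable (C j) by rewrite /C; case: pickP.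
have := ind F C mC.
have -> : \bigcap_(i in [set` F]) Y i @^-1` C i = [set e | forall k, B k (Y (g k) e)].
  apply/seteqP; split => e /= H.
    by move=> k; rewrite -Cg; apply: H; apply/imfsetP; exists k.
  by move=> j /imfsetP[k _ ->] /=; rewrite Cg.
move=> ->; have pF : perm_eq F [seq g k | k <- enum I].
  apply: uniq_perm; [exact: fset_uniq|by rewrite map_inj_uniq ?enum_uniq|].
  move=> j; apply/imfsetP/mapP => -[k _ ->]; first by exists k; rewrite ?mem_enum.
  by exists k.
rewrite (perm_big _ pF) big_map big_enum /=.
by apply: eq_bigr => k _; rewrite Cg.
Qed.

End finite_laws.

Section bernoulli.
Context {d : measure_display} {T : measurableType d} {R : realType}.
Variables (p : R) (J : choiceType).

Definition bern (I : finType) (r : R) (u : {ffun I -> bool}) : R :=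
  \prod_k (if u k then r else 1 - r).

Variables (Q : probability T R) (xi : J -> T -> bool).
Hypothesis xiP : bernoulli_field Q p xi.

Lemma bernoulli_prob j (b : bool) :
  Q (xi j @^-1` [set b]) = (if b then p else 1 - p)%:E.
Proof.
have [mxi Qxi _] := xiP.
have mt : measurable [set e | xi j e].
  by have := mxi j measurableT [set true] I; rewrite setTI.
case: b; first exact: Qxi.
have -> : xi j @^-1` [set false] = ~` [set e | xi j e].
  by apply/seteqP; split => e /=; [move=> ->|move/negP/negbTE].
by rewrite probability_setC// Qxi.
Qed.

Lemma bernoulli_law (I : finType) (g : I -> J) (u : {ffun I -> bool}) :
  injective g -> Q [set e | forall k, xi (g k) e = u k] = (bern p u)%:E.
Proof.
move=> ginj; have [_ _ ind] := xiP.
rewrite (independent_finType (B := fun k => [set u k]) ind ginj) //.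
rewrite /bern -prodEFin; apply: eq_bigr => k _; exact: bernoulli_prob.
Qed.

Lemma bernoulli_eventE (I : finType) (g : I -> J) (C : {ffun I -> bool} -> Prop) :
  [set e | C [ffun k => xi (g k) e]] =
  \bigcup_(u in [set u : {ffun I -> bool} | `[< C u >]]) [set e | forall k, xi (g k) e = u k].
Proof.
apply/seteqP; split => e /=.
  by move=> H; exists [ffun k => xi (g k) e] => /=; [exact/asboolP|move=> k; rewrite ffunE].
move=> [u /asboolP Cu H]; suff -> : [ffun k => xi (g k) e] = u by [].
by apply/ffunP => k; rewrite ffunE.
Qed.

Lemma measurable_bernoulli_point (I : finType) (g : I -> J) (u : {ffun I -> bool}) :
  measurable [set e | forall k, xi (g k) e = u k].
Proof.
have [mxi _ _] := xiP.
have -> : [set e | forall k, xi (g k) e = u k] =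
    ~` \bigcup_(k in [set k : I | predT k]) (~` (xi (g k) @^-1` [set u k])).
  apply/seteqP; split => e /=; first by move=> H [k _]; apply; exact: H.
  by move=> H k; apply: contrapT => ne; apply: H; exists k.
apply: measurableC; apply: measurable_bigcup_finType => k; apply: measurableC.
by rewrite -[X in measurable X]setTI; exact: mxi.
Qed.

Lemma measurable_bernoulli_event (I : finType) (g : I -> J) (C : {ffun I -> bool} -> Prop) :
  measurable [set e | C [ffun k => xi (g k) e]].
Proof.
rewrite bernoulli_eventE; apply: measurable_bigcup_finType => u.
exact: measurable_bernoulli_point.
Qed.

Lemma bernoulli_event (I : finType) (g : I -> J) (C : {ffun I -> bool} -> Prop) :
  injective g ->
  Q [set e | C [ffun k => xi (g k) e]] = (\sum_(u | `[< C u >]) bern p u)%:E.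
Proof.
move=> ginj; rewrite bernoulli_eventE measure_bigcup_finType.
- by rewrite -sumEFin; apply: eq_bigr => u _; exact: bernoulli_law.
- by move=> u; exact: measurable_bernoulli_point.
- move=> u v _ _ [e [/= Hu Hv]]; apply/ffunP => k; by rewrite -Hu -Hv.
Qed.

End bernoulli.

(* Both densities are marginals of a three-valued field with weights p, q and
   1 - p - q. *)
Lemma bern_coupling (R : realType) (I : finType) (p q : R)
    (C D : {ffun I -> bool} -> Prop) : 0 <= p -> 0 <= q -> p + q <= 1 ->
    (forall u v, C u -> D v -> exists k, u k && v k) ->
  \sum_(u | `[< C u >]) bern p u + \sum_(v | `[< D v >]) bern q v <= 1.
Proof.
move=> p0 q0 pq CD.
pose w (o : option bool) : R :=
  match o with Some true => p | Some false => q | None => 1 - p - q end.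
pose W (Z : {ffun I -> option bool}) := \prod_k w (Z k).
have w0 o : 0 <= w o by case: o => [[]|] //=; lra.
have W0 Z : 0 <= W Z by apply: prodr_ge0 => k _; exact: w0.
have sumo (P : pred (option bool)) : \sum_(o | P o) w o =
    (if P None then w None else 0) +
    ((if P (Some true) then w (Some true) else 0) +
     (if P (Some false) then w (Some false) else 0)).
  rewrite big_mkcond (bigD1 None)//= (bigD1 (Some true))//=
    (bigD1 (Some false))//= big1 ?addr0//.
  by case=> [[]|].
have marg (b : bool) (r : R) (E : {ffun I -> bool} -> Prop) :
    r = w (Some b) ->
    \sum_(u | `[< E u >]) bern r u =
    \sum_(Z : {ffun I -> option bool} | `[< E [ffun k => Z k == Some b] >]) W Z.
  move=> rE; rewrite [RHS](partition_big (fun Z : {ffun I -> option bool} =>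
    [ffun k => Z k == Some b]) (fun u => `[< E u >])) //=.
  apply: eq_bigr => u Eu.
  (* Each factor of [bern] is the weight of the values that project to [u k], so the product expands
     over the [Z] that project to [u]. *)
  have -> : bern r u = \prod_k \sum_(o | (o == Some b) == u k) w o.
    apply: eq_bigr => k _; rewrite sumo rE.
    by case: b (u k) {rE} => -[] /=; ring.
  rewrite bigA_distr_big_dep /=; apply: eq_bigl => Z.
  apply/familyP/andP => [H|[_ /eqP <-] k]; last by rewrite unfold_in ffunE.
  have -> : [ffun k => Z k == Some b] = u.
    by apply/ffunP => k; rewrite ffunE (eqP (H k)).
  by rewrite Eu.
rewrite (marg true p C)// (marg false q D)//.
have <- : \sum_Z W Z = 1.
  have -> : \sum_Z W Z = \prod_(k : I) \sum_o w o by rewrite bigA_distr_bigA.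
  rewrite big1// => k _; rewrite sumo /=; ring.
(* By [CD] no [Z] can satisfy both conditions, as some [Z k] would have two values. The sum for [D]
   therefore fits in the complement of the part for [C]. *)
rewrite [leRHS](bigID (fun Z : {ffun I -> option bool} =>
  `[< C [ffun k => Z k == Some true] >])) /= lerD2l.
rewrite big_mkcond [leRHS]big_mkcond; apply: ler_sum => Z _.
case: asboolP => DZ; case: asboolP => CZ //=.
have [k] := CD _ _ CZ DZ; rewrite !ffunE.
by case: (Z k) => [[]|].
Qed.

(** * Reduction to finitely many edge states *)

Section truncation.
Context {R : realType}.
Implicit Types (u v : R * R) (x : nat -> R * R) (s : nat * nat -> bool) (N : nat).

(** Open paths are finite, so connections and crossings are increasing unions of their truncations,
    each of which reads finitely many edge states. *)
Definition trunc N s : nat * nat -> bool :=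
  fun ij => [&& s ij, (ij.1 < N)%N & (ij.2 < N)%N].

Definition extend N (e : {ffun 'I_N * 'I_N -> bool}) : nat * nat -> bool :=
  fun ij => if insub ij.1 is Some a then
    if insub ij.2 is Some b then e (a, b) else false else false.

Definition ord_pair N (ab : 'I_N * 'I_N) : nat * nat := (val ab.1, val ab.2).

Lemma ord_pair_inj N : injective (@ord_pair N).
Proof. by move=> [a b] [a' b'] [/val_inj -> /val_inj ->]. Qed.

Lemma trunc_extend N s : trunc N s = extend [ffun ab => s (@ord_pair N ab)].
Proof.
apply/funext => -[i j]; rewrite /trunc /extend /=.
case: insubP => [a -> /= <-|/negbTE ->]; last by rewrite andbF.
case: insubP => [b -> /= <-|/negbTE ->]; last by rewrite !andbF.
by rewrite !andbT ffunE.
Qed.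

Lemma trunc_trunc M N s : (N <= M)%N -> trunc N (trunc M s) = trunc N s.
Proof.
move=> NM; apply/funext => -[i j]; rewrite /trunc /=.
have [iN|] := ltnP i N; last by rewrite !andbF.
have [jN|] := ltnP j N; last by rewrite !andbF.
by rewrite (leq_trans iN NM) (leq_trans jN NM) !andbT.
Qed.

Lemma delaunay_open_sub x s s' u v : (forall ij, s ij -> s' ij) ->
  delaunay_open x s u v -> delaunay_open x s' u v.
Proof. by move=> ss' [i [j [ui vj D sij]]]; exists i, j; split => //; exact: ss'. Qed.

Lemma clos_refl_trans_sub (T : Type) (r r' : T -> T -> Prop) (a b : T) :
  (forall a b, r a b -> r' a b) -> clos_refl_trans T r a b -> clos_refl_trans T r' a b.
Proof.
move=> rr'; elim => {a b} [a b /rr'|a|a b c _ h _ h'].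
- exact: rt_step.
- exact: rt_refl.
- exact: rt_trans h h'.
Qed.

Lemma trunc_sub M N s ij : (M <= N)%N -> trunc M s ij -> trunc N s ij.
Proof.
by move=> MN /and3P[sij i j]; rewrite /trunc sij (leq_trans i MN) (leq_trans j MN).
Qed.

Lemma trunc_min_max N s i j : (i < N)%N -> (j < N)%N ->
  trunc N s (minn i j, maxn i j) = s (minn i j, maxn i j).
Proof. by move=> iN jN; rewrite /trunc /= gtn_min gtn_max iN jN !andbT. Qed.

Lemma open_cluster_trunc x s u v : open_cluster x s u v <->
  exists N, open_cluster x (trunc N s) u v.
Proof.
split; last first.
  move=> [N]; apply: clos_refl_trans_sub => a b; apply: delaunay_open_sub.
  by move=> ij /andP[].
rewrite /open_cluster /=; elim => {u v} [u v|u|u w v _ [M HM] _ [N HN]].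
- move=> [i [j [ui vj D sij]]]; exists (maxn i j).+1; apply: rt_step.
  by exists i, j; split => //; rewrite trunc_min_max// ltnS ?leq_maxl ?leq_maxr.
- by exists 0%N; exact: rt_refl.
- exists (maxn M N); apply: (rt_trans _ _ _ w).
    apply: clos_refl_trans_sub HM => a b; apply: delaunay_open_sub => ij.
    exact/trunc_sub/leq_maxl.
  apply: clos_refl_trans_sub HN => a b; apply: delaunay_open_sub => ij.
  exact/trunc_sub/leq_maxr.
Qed.

(** As labels determine points, a cluster is infinite exactly when its labels are unbounded. This is
    a countable combination of events on finitely many states, which gives measurability. *)
Lemma percolatesP x s : injective x -> percolates x s <->
  exists i, forall m, exists j N, (m <= j)%N /\ open_cluster x (trunc N s) (x i) (x j).
Proof.
move=> xinj; pose J i := [set j | open_cluster x s (x i) (x j)].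
have clJ i : open_cluster x s (x i) = x @` J i.
  apply/seteqP; split => [v xv|_ [j Jj <-]//].
  by have [j _ jv] := open_cluster_range xv; exists j => //; rewrite /J /= jv.
split => -[i H]; exists i.
  move=> m; apply: contrapT => Hm; apply: H; rewrite clJ; apply: finite_image.
  apply: (@sub_finite_set _ _ `I_m); last exact: finite_II.
  move=> j; rewrite /J /= ltnNge => /open_cluster_trunc[N HN].
  by apply/negP => mj; apply: Hm; exists j, N.
rewrite clJ => /finite_seqP[t tE].
have [M HM] : exists M, forall v, v \in t -> forall j, x j = v -> (j < M)%N.
  elim: t {tE} => [|v t [M IH]]; first by exists 0%N.
  have [[j jv]|nv] := pselect (exists j, x j = v).
    exists (maxn j.+1 M) => w; rewrite in_cons => /orP[/eqP-> k|wt k kw].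
      by rewrite -jv => /xinj ->; rewrite leq_maxl.
    by apply: leq_trans (leq_maxr _ _); exact: IH kw.
  exists M => w; rewrite in_cons => /orP[/eqP-> k kv|wt k kw]; last exact: IH kw.
  by case: nv; exists k.
have [j [N [Mj xj]]] := H M.
have : [set` t] (x j) by rewrite -tE; exists j => //; apply/open_cluster_trunc; exists N.
by move=> /HM /(_ j erefl); rewrite ltnNge Mj.
Qed.

Lemma crossing_sub (L : R) x s s' : (forall ij, s ij -> s' ij) ->
  crossing L x s -> crossing L x s'.
Proof.
move=> ss' [h [v [[h2 E inj] c b]]]; exists h, v; split => //; split => // j /E.
by move=> [i1 [i2 [vE sij]]]; exists i1, i2; split => //; exact: ss'.
Qed.

Lemma crossing_trunc (L : R) x s : crossing L x s <-> exists N, crossing L x (trunc N s).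
Proof.
split => [[h [v [[h2 E inj] c b]]]|[N]]; last by apply: crossing_sub => ij /andP[].
have [N HN] : exists m, forall n, (m <= n)%N -> forall j, j \in iota 1 h.-1 ->
    voronoi_open x (trunc n s) (v j) (v j.+1).
  apply: eventually_seq => j; rewrite mem_iota => jh.
  have [|i1 [i2 [vE sij]]] := E j; first by lia.
  exists (maxn i1 i2).+1 => n; rewrite gtn_max => /andP[n1 n2].
  by exists i1, i2; rewrite trunc_min_max.
exists N, h, v; split => //; split => // j jh.
by apply: HN; rewrite // mem_iota; lia.
Qed.

Lemma crosses_trunc n l x : exists M, forall N, (M <= N)%N -> forall s,
  crosses n l x (trunc N s) <-> crosses n l x s.
Proof.
have [M HM] : exists m, forall N, (m <= N)%N ->
    forall ab, ab \in enum {: window n * window n} ->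
    ((edge_label (occupation n x) (labels n x) ab).1 < N)%N /\
    ((edge_label (occupation n x) (labels n x) ab).2 < N)%N.
  apply: eventually_seq => ab _.
  set e := edge_label _ _ _; exists (maxn e.1 e.2).+1 => N.
  by rewrite gtn_max => /andP[].
exists M => N MN s; rewrite /crosses.
suff -> : edge_states n x (trunc N s) = edge_states n x s by [].
apply/ffunP => ab; rewrite !ffunE /trunc.
by have [] := HM N MN ab; rewrite ?mem_enum// => -> ->; rewrite !andbT.
Qed.

End truncation.

Section edge_randomness.
Context {R : realType} {d : measure_display} {T : measurableType d}.
Variables (xi : nat * nat -> T -> bool).

Lemma measurable_trunc_event (Q : probability T R) (p : R) N
    (C : (nat * nat -> bool) -> Prop) : bernoulli_field Q p xi ->
  measurable [set e | C (trunc N (xi ^~ e))].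
Proof.
move=> xiP; have -> : [set e | C (trunc N (xi ^~ e))] =
    [set e | C (extend [ffun k => xi (@ord_pair N k) e])].
  by apply/seteqP; split => e /=; rewrite trunc_extend.
exact: (measurable_bernoulli_event xiP (@ord_pair N) (fun u => C (extend u))).
Qed.

Lemma measurable_percolates (Q : probability T R) (p : R) (x : nat -> R * R) :
  injective x -> bernoulli_field Q p xi -> measurable [set e | percolates x (xi ^~ e)].
Proof.
move=> xinj xiP; have -> : [set e | percolates x (xi ^~ e)] =
    \bigcup_i \bigcap_m \bigcup_j \bigcup_N [set e | (m <= j)%N /\
      open_cluster x (trunc N (xi ^~ e)) (x i) (x j)].
  apply/seteqP; split => e /=.
    move=> /(percolatesP _ xinj)[i H]; exists i => // m _.
    by have [j [N H']] := H m; exists j => //; exists N.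
  move=> [i _ H]; apply/(percolatesP _ xinj); exists i => m.
  by have [//|j _ [N _ H']] := H m; exists j, N.
apply: bigcupT_measurable => i; apply: bigcapT_measurable => m.
apply: bigcupT_measurable => j; apply: bigcupT_measurable => N.
exact: (measurable_trunc_event _
  (fun s => (m <= j)%N /\ open_cluster x s (x i) (x j)) xiP).
Qed.

Lemma measurable_crosses (Q : probability T R) (p : R) n l (x : nat -> R * R) :
  bernoulli_field Q p xi -> measurable [set e | crosses n l x (xi ^~ e)].
Proof.
move=> xiP; exact: (measurable_bernoulli_event xiP
  (edge_label (occupation n x) (labels n x)) (vertical_crossing l (occupation n x))).
Qed.

(** With the points fixed, the incompatibility is [crossing_crosses]. The finite coupling applies to
    truncated Voronoi crossings, and continuity from below removes the truncation. *)
Lemma crosses_crossing_le1 (P Q : probability T R) (p q : R) n l (x : nat -> R * R) :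
    injective x -> 0 <= p -> 0 <= q -> p + q <= 1 ->
    bernoulli_field P p xi -> bernoulli_field Q q xi ->
  (P [set e | crosses n l x (xi ^~ e)] +
   Q [set e | crossing (2 * l%:R) x (xi ^~ e)] <= 1)%E.
Proof.
move=> xinj p0 q0 pq Pxi Qxi.
have [M HM] := crosses_trunc n l x.
pose A N := [set e | crossing (2 * l%:R) x (trunc N (xi ^~ e))].
have mA N : measurable (A N) by exact: measurable_trunc_event Qxi.
have AE : [set e | crossing (2 * l%:R) x (xi ^~ e)] = \bigcup_N A N.
  by apply/seteqP; split => e /=; [move=> /crossing_trunc[N]; exists N|
    move=> [N _ H]; apply/crossing_trunc; exists N].
have le N : (P [set e | crosses n l x (xi ^~ e)] + Q (A N) <= 1)%E.
  (* [K] is at least [M], so truncation does not change [crosses], and at least [N], so both events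
     are functions of the same finite array of states. *)
  pose K := maxn M N.
  have -> : [set e | crosses n l x (xi ^~ e)] =
      [set e | crosses n l x (extend [ffun k => xi (@ord_pair K k) e])].
    by apply/seteqP; split => e /=; rewrite -(trunc_extend K (xi ^~ e)) =>
      /(HM K (leq_maxl _ _)).
  have -> : A N = [set e | crossing (2 * l%:R) x
      (trunc N (extend [ffun k => xi (@ord_pair K k) e]))].
    by apply/seteqP; split => e /=; rewrite -(trunc_extend K (xi ^~ e)) trunc_trunc// leq_maxr.
  rewrite (bernoulli_event Pxi (fun u => crosses n l x (extend u)) (@ord_pair_inj K)).
  rewrite (bernoulli_event Qxi (fun u => crossing (2 * l%:R) x (trunc N (extend u)))
    (@ord_pair_inj K)).
  rewrite -EFinD lee_fin; apply: bern_coupling => // u v Cu Dv.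
  have [[i j]] := crossing_crosses xinj Dv Cu.
  move=> /andP[]; rewrite /trunc /extend /=.
  case: insubP => // a _ _; case: insubP => // b _ _ uab /and3P[vab _ _].
  by exists (a, b); rewrite uab vab.
rewrite AE -leeBrDl ?fin_num_measure//; last exact: measurable_crosses Pxi.
have ndA : nondecreasing_seq A.
  move=> N1 N2 N12; apply/subsetPset => e; apply: crossing_sub => ij.
  exact: trunc_sub.
have := @nondecreasing_cvg_mu _ _ _ Q A mA (bigcupT_measurable _ mA) ndA.
move=> /cvg_lim <- //; apply: lime_le.
  apply: ereal_nondecreasing_is_cvgn => N1 N2 N12.
  by apply: le_measure; rewrite ?inE//; apply/subsetPset/ndA.
apply: nearW => N /=; rewrite leeBrDl ?fin_num_measure//.
exact: measurable_crosses Pxi.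
Qed.

End edge_randomness.

(** * Occupation of the cells *)

Section poisson_occupation.
Context {R : realType}.
Implicit Types (f : bool * int * int) (n : nat) (z : R * R).

Lemma counting_eq0 (T : choiceType) (A : set T) :
  counting A = 0%E :> \bar R <-> A = set0.
Proof.
rewrite /counting; case: asboolP => [fA|infA]; last first.
  by split => // A0; case: infA; rewrite A0; exact: finite_set0.
split => [[]|->]; last by rewrite fset_set0.
move=> /eqP; rewrite pnatr_eq0 cardfs_eq0 => /eqP h.
exact: fset_set_set0.
Qed.

Lemma counting_eq1 (T : choiceType) (A : set T) :
  counting A = 1%E :> \bar R <-> exists a, A = [set a].
Proof.
rewrite /counting; case: asboolP => [fA|infA]; last first.
  by split => // -[a A1]; case: infA; rewrite A1; exact: finite_set1.
split => [[]|[a ->]]; last by rewrite fset_set1 cardfs1.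
move=> /eqP; rewrite (eqr_nat R _ 1) => /cardfs1P[a h].
by exists a; rewrite -(fset_setK fA) h set_fset1.
Qed.

Definition count_class (c : \bar R) : option bool :=
  if c == 0%E then None else Some (c == 1%E).

Lemma measurable_count_class o : measurable [set c : \bar R | count_class c = o].
Proof.
have m0 : [set c : \bar R | count_class c = None] = [set 0%E].
  by apply/seteqP; split => c /=; rewrite /count_class; case: eqP.
have m1 : [set c : \bar R | count_class c = Some true] = [set 1%E].
  apply/seteqP; split => c /=; rewrite /count_class.
    by case: eqP => // _ [/eqP].
  by move=> ->; rewrite eqxx onee_eq0.
have m2 : [set c : \bar R | count_class c = Some false] = ~` [set 0%E] `&` ~` [set 1%E].
  apply/seteqP; split => c /=; rewrite /count_class.
    by case: eqP => // c0 [/eqP].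
  by move=> [/eqP/negbTE -> /eqP/negbTE ->].
case: o => [[]|]; rewrite ?m0 ?m1 ?m2.
- exact: emeasurable_set1.
- by apply: measurableI; apply: measurableC; exact: emeasurable_set1.
- exact: emeasurable_set1.
Qed.

Definition framed_tile n f (k : window n) : set (R * R) :=
  [set z | cell_of n (frame f z) = window_cell k].

Lemma framed_tileE n f (k : window n) : exists a b : R,
  framed_tile f k = (`[a, (a + mesh n)%R[ : set R) `*` (`[b, (b + mesh n)%R[ : set R).
Proof.
have interval (p m : int) : exists a : R, forall r,
    Num.floor (n.+1%:R * (r + p%:~R)) = m <-> a <= r < a + mesh n.
  exists (m%:~R * mesh n - p%:~R) => r.
  have n0 : 0 < n.+1%:R :> R by rewrite ltr0n.
  suff -> : (m%:~R * mesh n - p%:~R <= r < m%:~R * mesh n - p%:~R + mesh n) =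
      (Num.floor (n.+1%:R * (r + p%:~R)) == m) by split => /eqP.
  rewrite floor_eq intrD (mulrC n.+1%:R) -ler_pdivrMr// -ltr_pdivlMr// lerBlDr.
  congr (_ && _); rewrite -(ltrD2r p%:~R); congr (_ < _).
  by rewrite -/(mesh n); ring.
case: f => -[[] p] q.
  have [a Ha] := interval q (window_cell k).2; have [b Hb] := interval p (window_cell k).1.
  exists a, b; apply/seteqP; split => z /=; rewrite !in_itv /=.
    move=> h; split; [apply/Ha|apply/Hb]; by rewrite -h.
  by move=> [/Ha h1 /Hb h2]; rewrite /framed_tile /= [RHS]surjective_pairing -h1 -h2.
have [a Ha] := interval p (window_cell k).1; have [b Hb] := interval q (window_cell k).2.
exists a, b; apply/seteqP; split => z /=; rewrite !in_itv /=.
  move=> h; split; [apply/Ha|apply/Hb]; by rewrite -h.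
by move=> [/Ha h1 /Hb h2]; rewrite /framed_tile /= [RHS]surjective_pairing -h1 -h2.
Qed.

Lemma measurable_framed_tile n f (k : window n) : measurable (framed_tile f k).
Proof. by have [a [b ->]] := framed_tileE f k; apply: measurableX; exact: measurable_itv. Qed.

Lemma area_framed_tile n f (k : window n) :
  area (framed_tile f k) = ((mesh n * mesh n)%R)%:E :> \bar R.
Proof.
have itv (a : R) : lebesgue_measure `[a, (a + mesh n)%R[ = (mesh n)%:E.
  by rewrite lebesgue_measure_itv /= lte_fin ltrDl mesh_gt0 -EFinB addrC addKr.
have [a [b ->]] := framed_tileE f k.
by rewrite /area product_measure1E//= !itv.
Qed.

Lemma framed_tile_disjoint n f (k l : window n) z :
  framed_tile f k z -> framed_tile f l z -> k = l.
Proof. by rewrite /framed_tile /= => -> /window_cell_inj. Qed.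

(** Weights of 0, 1 and at least 2 points for a Poisson variable whose mean is the area of a tile.
    Neither the tile nor the frame enters, and this is all the invariance that is used. *)
Definition tile_weight n (o : option bool) : \bar R :=
  let w j := poisson_prob (1 * (mesh n * mesh n))%R j [set j] in
  match o with None => w 0%N | Some true => w 1%N
  | Some false => (1 - (w 0%N + w 1%N))%E end.

Context {d : measure_display} {T : measurableType d}.
Variables (mu : probability T R) (X : nat -> T -> R * R).
Hypothesis hX : poisson_process mu 1 X.

Lemma occupation_count n f w (k : window n) :
  occupation n (frame f \o X ^~ w) k = count_class (point_count X (framed_tile f k) w).
Proof.
have [_ Xinj _ _ _] := hX.
have c0 : point_count X (framed_tile f k) w = 0%E <->
    forall i, cell_of n (frame f (X i w)) <> window_cell k.
  rewrite /point_count counting_eq0; split => [e i h|H].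
    suff : (range (X ^~ w) `&` framed_tile f k) (X i w) by rewrite e.
    by split => //; exists i.
  by apply/seteqP; split => // z [[i _ <-] /H].
have c1 : point_count X (framed_tile f k) w = 1%E <->
    exists i, cell_of n (frame f (X i w)) = window_cell k /\
      forall j, cell_of n (frame f (X j w)) = window_cell k -> j = i.
  rewrite /point_count counting_eq1; split => [[a e]|[i [ik iu]]].
    have [[i _ ia] ik] : (range (X ^~ w) `&` framed_tile f k) a by rewrite e.
    exists i; split; first by rewrite ia.
    move=> j jk; apply: (Xinj w); rewrite ia.
    suff : (range (X ^~ w) `&` framed_tile f k) (X j w) by rewrite e.
    by split => //; exists j.
  exists (X i w); apply/seteqP; split => [z [[j _ <-] /iu ->]//|z ->].
  by split => //; exists i.
rewrite ffunE /count_class; case: asboolP => [/c0 ->|nc0]; first by rewrite eqxx.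
case: eqP => [/c0//|_]; congr Some.
by case: asboolP => [/c1/eqP ->|nc1] //; apply/esym/eqP => /c1.
Qed.

(** The classes of the count are countable combinations of the events that [X i] lies in the tile;
    exactly one point means that some [X i] is there and no other. *)
Lemma measurable_point_count n f (k : window n) o :
  measurable [set w | count_class (point_count X (framed_tile f k) w) = o].
Proof.
have [mX _ _ _ _] := hX.
have mA i : measurable (X i @^-1` framed_tile f k).
  by rewrite -[X in measurable X]setTI; apply: mX => //; exact: measurable_framed_tile.
have m0 : measurable [set w | occupation n (frame f \o X ^~ w) k = None].
  have -> : [set w | occupation n (frame f \o X ^~ w) k = None] =
      \bigcap_i ~` (X i @^-1` framed_tile f k).
    apply/seteqP; split => w /=; first by move=> /occupation_None H i _; exact: H.
    by move=> H; apply/occupation_None => i; exact: H.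
  by apply: bigcapT_measurable => i; exact: measurableC.
have m1 : measurable [set w | occupation n (frame f \o X ^~ w) k = Some true].
  have -> : [set w | occupation n (frame f \o X ^~ w) k = Some true] =
      \bigcup_i ((X i @^-1` framed_tile f k) `&`
        \bigcap_j (if j == i then setT else ~` (X j @^-1` framed_tile f k))).
    apply/seteqP; split => w /=.
      move=> /occupation_single[i [ik iu]]; exists i => //; split => // j _.
      by case: eqP => // ji; move=> /iu.
    move=> [i _ [ik H]]; apply/occupation_single; exists i; split => // j jk.
    by have := H j I; case: eqP.
  apply: bigcupT_measurable => i; apply: measurableI => //.
  apply: bigcapT_measurable => j; case: ifP => _ //; exact: measurableC.
have E p : [set w | count_class (point_count X (framed_tile f k) w) = p] =
    [set w | occupation n (frame f \o X ^~ w) k = p].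
  by apply/seteqP; split => w /=; rewrite occupation_count.
rewrite E; case: o => [[]|] //.
have -> : [set w | occupation n (frame f \o X ^~ w) k = Some false] =
    ~` [set w | occupation n (frame f \o X ^~ w) k = None] `&`
    ~` [set w | occupation n (frame f \o X ^~ w) k = Some true].
  apply/seteqP; split => w /=; first by move=> ->.
  by case: (occupation _ _ _) => [[]|] [].
by apply: measurableI; exact: measurableC.
Qed.

Lemma measurable_occupation n f (t : {ffun window n -> option bool}) :
  measurable [set w | occupation n (frame f \o X ^~ w) = t].
Proof.
have -> : [set w | occupation n (frame f \o X ^~ w) = t] =
    ~` \bigcup_(k in [set k | predT k])
        ~` [set w | count_class (point_count X (framed_tile f k) w) = t k].
  apply/seteqP; split => w /=.
    by move=> <- [k _]; apply; rewrite /= occupation_count.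
  move=> H; apply/ffunP => k; rewrite occupation_count.
  by apply: contrapT => ne; apply: H; exists k.
apply: measurableC; apply: measurable_bigcup_finType => k; apply: measurableC.
exact: measurable_point_count.
Qed.

Lemma point_count_law n f (k : window n) o :
  mu [set w | count_class (point_count X (framed_tile f k) w) = o] = tile_weight n o.
Proof.
have [_ _ _ pX _] := hX.
have ltA : (area (framed_tile f k) < +oo :> \bar R)%E by rewrite area_framed_tile ltry.
have pA := pX _ (measurable_framed_tile f k) ltA.
rewrite area_framed_tile /= in pA.
have mC := measurable_point_count f k.
have e0 : mu [set w | count_class (point_count X (framed_tile f k) w) = None] =
    tile_weight n None.
  rewrite /tile_weight -pA; congr (mu _); apply/seteqP; split => w /=; rewrite /count_class.
    by case: eqP.
  by move=> ->; rewrite eqxx.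
have e1 : mu [set w | count_class (point_count X (framed_tile f k) w) = Some true] =
    tile_weight n (Some true).
  rewrite /tile_weight -pA; congr (mu _); apply/seteqP; split => w /=; rewrite /count_class.
    by case: eqP => // _ [/eqP].
  by move=> ->; rewrite onee_eq0 eqxx.
case: o => [[]|] //.
have -> : tile_weight n (Some false) =
  (1 - (tile_weight n None + tile_weight n (Some true)))%E by [].
rewrite -e0 -e1.
rewrite -measureU//; last first.
  by apply/seteqP; split => // w [/= ->].
rewrite -probability_setC; last exact: measurableU.
congr (mu _); apply/seteqP; split => w /=; first by move=> -> [].
by case: (count_class _) => [[]|] H //; case: H; [right|left].
Qed.

Lemma occupation_law n f (t : {ffun window n -> option bool}) :
  mu [set w | occupation n (frame f \o X ^~ w) = t] = (\prod_k tile_weight n (t k))%E.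
Proof.
have [_ _ _ _ indX] := hX.
(* Independence is given for sequences of disjoint sets: tiles are numbered by [pickle], and the
   remaining indices get the empty set. *)
pose pk := @choice.pickle (window n).
pose A m := if @pickle_inv (window n) m is Some k then framed_tile f (k : window n) else set0.
have Ak k : A (pk k) = framed_tile f k by rewrite /A /pk pickleK_inv.
have mA m : measurable (A m).
  by rewrite /A; case: pickle_inv => // k; exact: measurable_framed_tile.
have tA : trivIset setT A.
  move=> i j _ _ [z []]; rewrite /A.
  have := @pickle_invK (window n) i; have := @pickle_invK (window n) j.
  case: (@pickle_inv (window n) i) (@pickle_inv (window n) j) => [k|] [l|] //= <- <- zk zl.
  by rewrite (framed_tile_disjoint zk zl).
have := independent_finType (B := fun k => [set c | count_class c = t k]) (indX A mA tA)
  (g := pk) _ _.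
have -> : [set w | occupation n (frame f \o X ^~ w) = t] =
  [set w | forall k, [set c | count_class c = t k] (point_count X (A (pk k)) w)].
  apply/seteqP; split => w /=; first by move=> <- k; rewrite Ak occupation_count.
  by move=> H; apply/ffunP => k; rewrite occupation_count -H Ak.
move=> ->; last 2 first.
- by move=> k k' /(pcan_inj choice.pickleK).
- by move=> k; exact: measurable_count_class.
apply: eq_bigr => k _; rewrite -(point_count_law f k) Ak.
by [].
Qed.

End poisson_occupation.

(** * Probability of crossing an annulus *)

Section integral_tools.
Context {d : measure_display} {T : measurableType d} {R : realType}.

(* The integral of a nonnegative function is a lower integral, so that
   monotonicity needs no measurability. *)
Lemma ge0_le_lower_integral (mu : {measure set T -> \bar R}) (f g : T -> \bar R) :
  (forall x, 0 <= f x)%E -> (forall x, f x <= g x)%E ->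
  (\int[mu]_x f x <= \int[mu]_x g x)%E.
Proof.
move=> f0 fg; rewrite !ge0_integralE//; last first.
  by move=> x _; exact: le_trans (f0 x) (fg x).
apply: le_ereal_sup => _ [h hf <-]; exists h => //= x.
by apply: le_trans (hf x) _; rewrite !patch_setT.
Qed.

Lemma integral_finite_range (mu : {measure set T -> \bar R}) (I : finType)
    (Y : T -> I) (G : I -> R) : (forall i, measurable [set w | Y w = i]) ->
    (forall i, 0 <= G i) ->
  (\int[mu]_w (G (Y w))%:E = \sum_i (G i)%:E * mu [set w | Y w = i])%E.
Proof.
move=> mY G0.
transitivity (\int[mu]_w (\sum_i ((G i)%:E * (\1_[set w | Y w = i] w)%:E)))%E.
  apply: eq_integral => w _; rewrite (bigD1 (Y w))//= big1.
    by rewrite indicE mem_set// mule1 adde0.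
  move=> i iY; rewrite indicE memNset ?mule0// => /= Yi.
  by rewrite Yi eqxx in iY.
have mi i : measurable_fun setT (fun w => (\1_[set w | Y w = i] w)%:E : \bar R).
  by apply/measurable_EFinP; exact: measurable_indic.
rewrite ge0_integral_sum//; last 2 first.
- by move=> i; apply: measurable_funeM.
- by move=> i w _; rewrite mule_ge0 ?lee_fin.
by apply: eq_bigr => i _; rewrite ge0_integralZl_EFin// integral_indic// setIT.
Qed.

(** The lower limit is an increasing union of intersections, each contained in some set of measure
    at most [c]. *)
Lemma measure_liminf_le (m : {measure set T -> \bar R}) (A : nat -> set T) (c : \bar R) :
    (forall n, measurable (A n)) ->
    (forall k, exists2 n, (k <= n)%N & (m (A n) <= c)%E) ->
  (m (\bigcup_k \bigcap_(n in [set n | (k <= n)%N]) A n) <= c)%E.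
Proof.
move=> mA Ac.
pose D k := \bigcap_(n in [set n | (k <= n)%N]) A n.
have mD k : measurable (D k) by apply: bigcap_measurable => //; exists k => /=.
have ndD : nondecreasing_seq D.
  by move=> k l kl; apply/subsetPset => x Dx n /= ln; apply: Dx; exact: leq_trans ln.
have := @nondecreasing_cvg_mu _ _ _ m D mD (bigcupT_measurable _ mD) ndD.
move=> /cvg_lim <- //; apply: lime_le.
  apply: ereal_nondecreasing_is_cvgn => k l kl.
  by apply: le_measure; rewrite ?inE//; apply/subsetPset/ndD.
apply: nearW => k /=; have [n kn An] := Ac k.
apply: le_trans An; apply: le_measure; rewrite ?inE//.
by move=> x; apply.
Qed.

Lemma measure_bigsetU_le (m : {measure set T -> \bar R}) (I : eqType) (s : seq I)
    (B : I -> set T) (c : R) : (forall i, measurable (B i)) ->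
    (forall i, i \in s -> m (B i) <= c%:E)%E ->
  (m (\big[setU/set0]_(i <- s) B i) <= ((size s)%:R * c)%:E)%E.
Proof.
move=> mB; elim: s => [|i s IH] Bc; first by rewrite big_nil measure0 mul0r.
rewrite big_cons.
apply: (@le_trans _ _ (m (B i) + m (\big[setU/set0]_(j <- s) B j))%E).
  by apply: measureU2 => //; exact: bigsetU_measurable.
rewrite /= -natr1 mulrDl mul1r EFinD [leRHS]addeC; apply: leeD; first exact/Bc/mem_head.
by apply: IH => j js; apply: Bc; rewrite in_cons js orbT.
Qed.

End integral_tools.

Section annulus_event.
Context {R : realType} {d1 d2 : measure_display}.
Context {T1 : measurableType d1} {T2 : measurableType d2}.
Variables (mu : probability T1 R) (X : nat -> T1 -> R * R).
Variables (xi : nat * nat -> T2 -> bool).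
Hypothesis hX : poisson_process mu 1 X.

Definition crosses_event n l f : set (T1 * T2) :=
  [set we | crosses n l (frame f \o X ^~ we.1) (xi ^~ we.2)].

Lemma edge_label_eq n (t : {ffun window n -> option bool})
    (lab lab' : {ffun window n -> nat}) ab :
  (forall k, t k = Some true -> lab k = lab' k) -> edge_label t lab ab = edge_label t lab' ab.
Proof.
move=> H; rewrite /edge_label; case: ifP => // /and3P[/eqP /H -> /eqP /H -> _] //.
Qed.

Lemma xsection_crosses n l f w :
  xsection (crosses_event n l f) w = [set e | crosses n l (frame f \o X ^~ w) (xi ^~ e)].
Proof. by rewrite /xsection; apply/seteqP; split => e /=; rewrite ?inE// -in_setE. Qed.

Variables (Q : probability T2 R) (p : R).
Hypothesis p01 : 0 <= p <= 1.
Hypothesis xiP : bernoulli_field Q p xi.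

(** The labels depend on the points, so the event is cut into countably many products, one for each
    occupation and each choice of labels. [W] constrains the labels of the singly occupied cells,
    the only ones that [edge_label] reads. *)
Lemma measurable_crosses_event n l f : measurable (crosses_event n l f).
Proof.
have [mX _ _ _ _] := hX.
pose W (t : {ffun window n -> option bool}) (lab : {ffun window n -> nat}) : set T1 :=
  [set w | occupation n (frame f \o X ^~ w) = t] `&`
  ~` \bigcup_(k in [set k | t k == Some true]) ~` (X (lab k) @^-1` framed_tile f k).
pose V t (lab : {ffun window n -> nat}) : set T2 :=
  [set e | vertical_crossing (R := R) l t [ffun ab => xi (edge_label t lab ab) e]].
have -> : crosses_event n l f =
    \bigcup_(t in [set t | predT t]) \bigcup_lab (W t lab `*` V t lab).
  apply/seteqP; split => -[w e] /=; rewrite /crosses_event /crosses /=.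
    move=> H; exists (occupation n (frame f \o X ^~ w)) => //.
    exists (labels n (frame f \o X ^~ w)) => //; split => //; split => //.
    move=> [k /= /eqP kt]; apply; have /occupation_single[i [ik iu]] := kt.
    by rewrite (labels_single kt ik).
  move=> [t _ [lab _ [[/= tE H] Ve]]]; rewrite /= tE; move: Ve; rewrite /V /=.
  suff -> : edge_states n (frame f \o X ^~ w) (xi ^~ e) =
    [ffun ab => xi (edge_label t lab ab) e] by [].
  apply/ffunP => ab; rewrite !ffunE tE; congr (xi _ e).
  apply: edge_label_eq => k tk; apply: labels_single; first by rewrite tE.
  by apply: contrapT => ne; apply: H; exists k => //=; rewrite tk.
apply: measurable_bigcup_finType => t; apply: countable_bigcupT_measurable.
  exact: countableP.
move=> lab; apply: measurableX.
  apply: measurableI; first exact: measurable_occupation hX _ _ _.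
  apply: measurableC; apply: measurable_bigcup_finType => k; apply: measurableC.
  rewrite -[X in measurable X]setTI; apply: mX => //; exact: measurable_framed_tile.
exact: (measurable_bernoulli_event xiP (edge_label t lab) (vertical_crossing (R := R) l t)).
Qed.

Lemma labels_inj n x (a b : window n) : occupation n x a = Some true ->
  occupation n x b = Some true -> labels n (x : nat -> R * R) a = labels n x b -> a = b.
Proof.
move=> sa sb; have /occupation_single[i [ia _]] := sa.
have /occupation_single[j [jb _]] := sb.
rewrite (labels_single sa ia) (labels_single sb jb) => ij.
by apply: window_cell_inj; rewrite -ia -jb ij.
Qed.

(** Given the points, the edge states are independent, so the probability of a section depends on
    the occupation alone, and the law of the occupation is the same in all frames. *)
Lemma crosses_event_prob n l f : (mu \x Q)%E (crosses_event n l f) =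
  (\sum_(t : {ffun window n -> option bool})
    (\sum_(u | `[< vertical_crossing (R := R) l t u >]) bern p u)%:E *
    \prod_k tile_weight n (t k))%E.
Proof.
pose G (t : {ffun window n -> option bool}) :=
  \sum_(u | `[< vertical_crossing (R := R) l t u >]) bern p u.
have sec w : Q (xsection (crosses_event n l f) w) =
    (G (occupation n (frame f \o X ^~ w)))%:E.
  rewrite xsection_crosses.
  apply: (bernoulli_event xiP (g := edge_label (occupation n (frame f \o X ^~ w))
    (labels n (frame f \o X ^~ w)))
    (vertical_crossing (R := R) l (occupation n (frame f \o X ^~ w)))).
  by apply: edge_label_inj => a b; exact: labels_inj.
rewrite /product_measure1 /=; under eq_integral do rewrite sec.
rewrite (integral_finite_range mu (Y := fun w => occupation n (frame f \o X ^~ w)) (G := G)).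
- by apply: eq_bigr => t _; rewrite -(occupation_law hX f t).
- by move=> t; exact: measurable_occupation hX _ _ _.
- move=> t; apply: sumr_ge0 => u _; apply: prodr_ge0 => k _.
  by case: ifP => _; move: p01 => /andP[? ?]; lra.
Qed.

Lemma crosses_event_frame n l f f' :
  (mu \x Q)%E (crosses_event n l f) = (mu \x Q)%E (crosses_event n l f').
Proof. by rewrite !crosses_event_prob. Qed.

Lemma frame_id z : frame (false, 0, 0) z = z :> R * R.
Proof. by case: z => z1 z2; rewrite /frame /= !addr0. Qed.

Lemma crosses_event_crossing (Q' : probability T2 R) (q : R) n l f :
    0 <= q -> p + q <= 1 -> bernoulli_field Q' q xi ->
  ((mu \x Q) (crosses_event n l f) +
   (mu \x Q') [set we | crossing (2 * l%:R) (X ^~ we.1) (xi ^~ we.2)] <= 1)%E.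
Proof.
move=> q0 pq xiP'; have [_ Xinj _ _ _] := hX.
(* In the identity frame both crossings concern the same points and the same rectangle. *)
rewrite (crosses_event_frame _ _ _ (false, 0, 0)).
set B := crosses_event _ _ _; set C := [set we | _].
pose g w := Q (xsection B w).
have mB : measurable B by exact: measurable_crosses_event.
have mg : measurable_fun setT g by exact: measurable_fun_xsection.
have g1 w : (g w <= 1)%E by apply: probability_le1; exact: measurable_xsection.
have mh : measurable_fun setT (fun w => 1 - g w)%E.
  by apply: emeasurable_funB => //; exact: measurable_cst.
have gfin w : g w \is a fin_num by rewrite fin_num_measure//; exact: measurable_xsection.
have h0 w : (0 <= 1 - g w)%E by rewrite leeBrDr// add0e.
(* The sections of [C] are replaced by the measurable bound [1 - g], whose integral can be added to
   that of [g]. *)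
have le : ((mu \x Q') C <= \int[mu]_w (1 - g w))%E.
  apply: ge0_le_lower_integral => w //=.
  rewrite leeBrDr// addeC /g xsection_crosses.
  have -> : frame (false, 0, 0) \o X ^~ w = X ^~ w.
    by apply/funext => i; exact: frame_id.
  have -> : xsection C w = [set e | crossing (2 * l%:R) (X ^~ w) (xi ^~ e)].
    by rewrite xsectionE.
  move: p01 => /andP[p0 _].
  exact: (crosses_crossing_le1 n l (Xinj w) p0 q0 pq xiP xiP').
apply: le_trans (leeD2l _ le) _.
rewrite /product_measure1 /= -/g -ge0_integralD//.
under eq_integral => w _ do rewrite addeC subeK//.
by rewrite integral_cst// mul1e; exact: probability_le1.
Qed.

End annulus_event.

(** * Comparison of the critical probabilities *)

Section duality.
Context {R : realType} {d1 d2 : measure_display}.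
Context {T1 : measurableType d1} {T2 : measurableType d2}.
Variables (mu : probability T1 R) (X : nat -> T1 -> R * R).
Variables (nu : R -> probability T2 R) (xi : nat * nat -> T2 -> bool).
Hypothesis hX : poisson_process mu 1 X.
Hypothesis hxi : forall p : R, 0 <= p <= 1 -> bernoulli_field (nu p) p xi.

(** Section by section, percolation is contained in the measurable lower limit [S]. Each [U n l]
    with [l0 <= l] has measure at most 1/2 by the union bound over the four frames, and lower limits
    preserve the bound. *)
Lemma theta_le_half (p : R) l0 : 0 <= p <= 1 ->
    (forall n l f, (l0 <= l)%N ->
      ((mu \x nu p) (crosses_event X xi n l f) <= (1 / 8)%:E)%E) ->
  (theta mu X nu xi p <= (1 / 2)%:E)%E.
Proof.
move=> p01 H; have [_ Xinj Xlf _ _] := hX; have xiP := hxi p01.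
pose m : {measure set (T1 * T2) -> \bar R} := (mu \x nu p)%E.
pose U n l := \big[setU/set0]_(f <- annulus_frames l) crosses_event X xi n l f.
have mU n l : measurable (U n l).
  by apply: bigsetU_measurable => f _; exact: (measurable_crosses_event hX xiP).
pose Z l := \bigcup_k \bigcap_(n in [set n | (k <= n)%N]) U n l.
have mZ l : measurable (Z l).
  apply: bigcupT_measurable => k; apply: bigcap_measurable => //.
  by exists k => /=.
have mUle n l : (l0 <= l)%N -> (m (U n l) <= (1 / 2)%:E)%E.
  move=> ll; apply: (@le_trans _ _ ((size (annulus_frames l))%:R * (1 / 8))%:E).
    apply: measure_bigsetU_le => f; first exact: (measurable_crosses_event hX xiP).
    by move=> _; exact: H.
  by rewrite lee_fin /=; lra.
have mZle l : (l0 <= l)%N -> (m (Z l) <= (1 / 2)%:E)%E.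
  by move=> ll; apply: measure_liminf_le => // k; exists k => //; exact: mUle.
pose S := \bigcup_k \bigcap_(l in [set l | (k <= l)%N]) Z l.
have mS : measurable S.
  apply: bigcupT_measurable => k; apply: bigcap_measurable => //.
  by exists k => /=.
have mSle : (m S <= (1 / 2)%:E)%E.
  apply: measure_liminf_le => // k; exists (maxn k l0); first exact: leq_maxl.
  by apply: mZle; exact: leq_maxr.
apply: le_trans mSle; rewrite /theta /m.
apply: ge0_le_lower_integral => w //=.
apply: le_measure; rewrite ?inE.
- have -> : xsection [set we | percolates (X ^~ we.1) (xi ^~ we.2)] w =
    [set e | percolates (X ^~ w) (xi ^~ e)] by rewrite xsectionE.
  exact: measurable_percolates (Xinj w) xiP.
- exact: measurable_xsection.
- move=> e; rewrite !xsectionE /= => /(percolates_crosses (Xinj w) (Xlf w))[k Hk].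
  exists k => // l kl; have [k' Hk'] := Hk l kl.
  exists k' => // n kn; have [f fl cr] := Hk' n kn.
  by rewrite /U -bigcup_seq; exists f.
Qed.

Lemma eta_star_eventually (q : R) : eta_star mu X nu xi q = 1%E ->
  exists l0, forall l, (l0 <= l)%N -> ((1 - 1 / 8)%:E <=
    (mu \x nu q) [set we | crossing (2 * l%:R) (X ^~ we.1) (xi ^~ we.2)])%E.
Proof.
move=> eta1; have : ((1 - 1 / 8)%:E < eta_star mu X nu xi q)%E.
  by rewrite eta1 lte_fin; lra.
rewrite /eta_star limf_einfE => /ereal_sup_gt[_ [V [M [_ MV]] <-] lt].
exists (Num.bound `|M|) => l Ml.
apply: le_trans (ltW lt) _; apply: ereal_inf_lbound.
exists (2 * l%:R) => //; apply: MV.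
have M1 : `|M| < l%:R.
  by apply: (@lt_le_trans _ _ (Num.bound `|M|)%:R); [exact: archi_boundP|rewrite ler_nat].
by have := ler_norm M; have := normr_ge0 M; lra.
Qed.

Lemma critical_pair (p q : R) : 0 < p <= 1 -> 0 < q <= 1 ->
  theta mu X nu xi p = 1%E -> eta_star mu X nu xi q = 1%E -> 1 <= p + q.
Proof.
move=> /andP[p0 p1] /andP[q0 q1] th /eta_star_eventually[l0 Hl0].
rewrite leNgt; apply/negP => pq.
have p01 : 0 <= p <= 1 by rewrite (ltW p0).
have q01 : 0 <= q <= 1 by rewrite (ltW q0).
suff : (theta mu X nu xi p <= (1 / 2)%:E)%E by rewrite th lee_fin; lra.
apply: (@theta_le_half p l0) => // n l f ll.
have := crosses_event_crossing hX p01 (hxi p01) n l f (ltW q0) (ltW pq) (hxi q01).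
have := Hl0 l ll.
move: ((mu \x nu p)%E _) ((mu \x nu q)%E _) => a b hb hab.
have := le_trans (leeD2l a hb) hab.
case: a {hab} => [r| |] //; last by move=> _; exact: leNye.
by rewrite -EFinD !lee_fin; lra.
Qed.

End duality.

Theorem corollary2 (R : realType) (d1 d2 : measure_display)
    (T1 : measurableType d1) (T2 : measurableType d2)
    (mu : probability T1 R) (X : nat -> T1 -> R * R)
    (nu : R -> probability T2 R) (xi : nat * nat -> T2 -> bool)
    (hX : poisson_process mu 1 X)
    (hxi : forall p : R, 0 <= p <= 1 -> bernoulli_field (nu p) p xi) :
  (1 <= p_c mu X nu xi + p_c_star mu X nu xi)%E.
Proof.
have pc0 : (0 <= p_c mu X nu xi)%E.
  by apply: le_ereal_inf_tmp => _ [p [/andP[p0 _] _] <-]; rewrite lee_fin ltW.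
have pcs0 : (0 <= p_c_star mu X nu xi)%E.
  by apply: le_ereal_inf_tmp => _ [p [/andP[p0 _] _] <-]; rewrite lee_fin ltW.
have key (p : R) : 0 < p <= 1 -> theta mu X nu xi p = 1%E ->
    ((1 - p)%:E <= p_c_star mu X nu xi)%E.
  move=> p01 th; apply: le_ereal_inf_tmp => _ [q [q01 eta] <-].
  by rewrite lee_fin lerBlDl; exact: critical_pair eta.
case: (p_c_star mu X nu xi) pcs0 key => [r| |] // r0 key.
  (* For a finite [r] the inequality is moved to [p_c] alone, so that it can be checked on each
     density of which [p_c] is the infimum. *)
  rewrite -leeBlDr//; apply: le_ereal_inf_tmp => _ [p [p01 th] <-].
  by have := key p p01 th; rewrite -EFinB !lee_fin; lra.
(* Here no density satisfies the condition on [eta_star]; as [p_c] is nonnegative, the sum is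
   [+oo]. *)
by rewrite addey ?leey// gt_eqF// (lt_le_trans _ pc0).
Qed.
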